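(* For every $k\in\mathbb{Z}$, the $\mathbb{T}^2$-cobordism class of the Hirzebruch surface $M_k^4$ (with its natural $\mathbb{T}^2$-action) is trivial. In particular, the oriented cobordism class of a Hirzebruch surface is also trivial.
   Context: $\mathbb{T}^n=U(1)^n=(\mathbb{Z}^n\otimes\mathbb{R})/\mathbb{Z}^n$. A simple $n$-polytope is a convex $n$-polytope in which exactly $n$ facets (codimension-one faces) meet at each vertex. A smooth $\mathbb{T}^n$-action on a smooth $2n$-manifold $M$ is locally standard if every $y\in M$ has a $\mathbb{T}^n$-stable open neighbourhood $U_y$, a diffeomorphism $\psi:U_y\to V$ onto a $\mathbb{T}^n$-stable open subset $V\subset\mathbb{C}^n$ (standard action), and an automorphism $\delta_y$ of $\mathbb{T}^n$ with $\psi(t\cdot x)=\delta_y(t)\cdot\psi(x)$ for all $t\in\mathbb{T}^n$, $x\in U_y$. A closed smooth $2n$-dimensional $\mathbb{T}^n$-manifold $M$ is a quasitoric manifold over a simple $n$-polytope $P$ if the action is locally standard and there is a projection $\mathfrak{q}:M\to P$, whose fibres are exactly the orbits, mapping each $l$-dimensional orbit to a point in the relative interior of an $l$-dimensional face of $P$. The Hirzebruch surface for $k\in\mathbb{Z}$ is $\mathbb{CP}(L(k)\oplus\mathbb{C})$, the projectivisation of $L(k)\oplus\mathbb{C}$ over $\mathbb{CP}^1$, where $L(k)$ is the complex line bundle over $\mathbb{CP}^1$ with first Chern class $k$. With its natural $\mathbb{T}^2$-action it is equivariantly homeomorphic to the following quasitoric manifold $M_k^4$ over a square $Q=ABCD$: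 assign to the edges $AB,BC,CD,DA$ the vectors (up to sign) $(0,1),(1,0),(0,1),(1,k)\in\mathbb{Z}^2$, and put $M_k^4=(\mathbb{T}^2\times Q)/\sim$, where $(t,p)\sim(u,q)$ iff $p=q$ and $tu^{-1}$ lies in the subtorus of $\mathbb{T}^2$ corresponding to the submodule of $\mathbb{Z}^2$ generated by the vectors of the edges containing $p$; $\mathbb{T}^2$ acts by multiplication on the first factor. Two oriented $2n$-dimensional quasitoric manifolds $M_1,M_2$ are $\mathbb{T}^n$-cobordant if there is a compact oriented smooth $\mathbb{T}^n$-manifold $W$ with boundary such that $\partial W$ is $\mathbb{T}^n$-equivariantly diffeomorphic, by an orientation-preserving diffeomorphism, to $M_1\sqcup(-M_2)$, where $-M_2$ is $M_2$ with reversed orientation. The $\mathbb{T}^n$-cobordism class of $M$ is trivial if the same holds with $M_2=\emptyset$, i.e. $M$ is equivariantly diffeomorphic, preserving orientation, to $\partial W$ for some such $W$. *)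

(* Defs.v *)
From HB Require Import structures.
From mathcomp Require Import all_boot all_order all_algebra.
From mathcomp Require Import generic_quotient complex ring.
From mathcomp Require Import all_classical all_reals all_analysis.

Set Implicit Arguments.
Unset Strict Implicit.
Unset Printing Implicit Defensive.

Import Order.TTheory GRing.Theory Num.Theory.
Import numFieldNormedType.Exports.

Local Open Scope classical_set_scope.
Local Open Scope ring_scope.
Local Open Scope quotient_scope.
Local Open Scope complex_scope.

(** * Smooth maps between subsets of Euclidean spaces *)

Section Smooth.
Context {R : realType}.

Fixpoint Cr (r m p : nat) (f : 'rV[R]_m -> 'rV[R]_p) (U : set 'rV[R]_m) : Prop :=
  if r is r'.+1 then
    (forall x, U x -> differentiable f x) /\
    (forall i : 'I_m, Cr r' (fun x => 'D_(delta_mx 0 i) f x) U)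
  else forall x, U x -> {for x, continuous f}.

(* [S] need not be open: [f] has to extend smoothly near each point of [S]. *)
Definition smooth_on (m p : nat) (S : set 'rV[R]_m) (f : 'rV[R]_m -> 'rV[R]_p) :
    Prop :=
  forall x, S x ->
    exists (U : set 'rV[R]_m) (g : 'rV[R]_m -> 'rV[R]_p),
      [/\ open U, U x, (forall r, Cr r g U) &
          forall y, U y -> S y -> g y = f y].

(* Jacobian matrices at boundary points of a half-space depend on the values
   outside of it, so signs are only tested at interior points; by continuity
   this decides the sign at the remaining points. *)
Definition positive_on (m : nat) (S : set 'rV[R]_m) (f : 'rV[R]_m -> 'rV[R]_m) :
    Prop :=
  forall x, S° x -> 0 < \det ('J f x).

End Smooth.

(** * Manifolds *)

Record chart (R : realType) (T : Type) (d : nat) := Chart {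
  dom : set T;
  cmap : T -> 'rV[R]_d;
  cinv : 'rV[R]_d -> T  (* inverse of [cmap] on [cmap @` dom] *)
}.

(* A manifold is carried by a subset of a topological space, so that the
   boundary of a manifold is again one. *)
Record mfd (R : realType) (d : nat) := Mfd {
  mtype : topologicalType;
  mset : set mtype;
  matlas : set (chart R mtype d)
}.
Arguments mset {R d}.
Arguments matlas {R d}.

Section Manifolds.
Context {R : realType}.

(* With this half-space the first coordinate vector points outwards, and
   dropping the first coordinate of a positive chart gives a positive chart of
   the boundary for the "outward normal first" convention. *)
Definition halfspace (d : nat) : set 'rV[R]_(1 + d) := [set x | x 0 0 <= 0].

(* [c] is a homeomorphism from an open subset of [M] to an open subset of [K];
   [K] is the whole space or [halfspace]. *)
Definition is_chart (d : nat) (K : set 'rV[R]_d) (M : mfd R d)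
    (c : chart R (mtype M) d) : Prop :=
  [/\ exists O : set (mtype M), open O /\ dom c = mset M `&` O,
      exists V : set 'rV[R]_d, open V /\ cmap c @` dom c = K `&` V,
      forall x, dom c x -> cinv c (cmap c x) = x,
      {within dom c, continuous (cmap c)} &
      {within cmap c @` dom c, continuous (cinv c)}].

(* The atlas determines both the smooth structure and the orientation, which
   for an atlas is only meaningful if [1 < d], or [0 < d] and [K = setT]. *)
Definition compact_oriented_mfd (d : nat) (K : set 'rV[R]_d) (M : mfd R d) :
    Prop :=
  [/\ hausdorff_space (subspace (mset M)),
      compact (mset M),
      forall c, matlas M c -> is_chart K c,
      forall x, mset M x -> exists2 c, matlas M c & dom c x &
      forall b c, matlas M b -> matlas M c ->
        smooth_on (cmap b @` (dom b `&` dom c)) (cmap c \o cinv b) /\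
        positive_on (cmap b @` (dom b `&` dom c)) (cmap c \o cinv b)].

Definition boundary_chart (T : Type) (d : nat) (c : chart R T (1 + d)) :
    chart R T d :=
  Chart (dom c `&` [set x | cmap c x 0 0 = 0])
        (fun x => rsubmx (cmap c x))
        (fun y => cinv c (row_mx 0 y)).

Definition boundary (d : nat) (W : mfd R (1 + d)) : mfd R d :=
  Mfd [set x | exists2 c, matlas W c & dom (boundary_chart c) x]
      [set boundary_chart c | c in matlas W].

Definition reflect_fst (d : nat) (x : 'rV[R]_d) : 'rV[R]_d :=
  \row_i (if i == 0%N :> nat then - x 0 i else x 0 i).

Definition reflect_chart (T : Type) (d : nat) (c : chart R T d) : chart R T d :=
  Chart (dom c) (@reflect_fst d \o cmap c) (cinv c \o @reflect_fst d).

(* [M] itself, or [M] with the reversed orientation (for [0 < d] and [M]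
   without boundary). *)
Definition orient (d : nat) (positive : bool) (M : mfd R d) : mfd R d :=
  Mfd (mset M)
      (if positive then matlas M else [set reflect_chart c | c in matlas M]).

Definition smooth_map (m d : nat) (M : mfd R m) (N : mfd R d)
    (f : mtype M -> mtype N) : Prop :=
  [/\ forall x, mset M x -> mset N (f x),
      {within mset M, continuous f} &
      forall b c, matlas M b -> matlas N c ->
        smooth_on (cmap b @` (dom b `&` f @^-1` dom c))
                  (cmap c \o f \o cinv b)].

Definition oriented_diffeomorphism (d : nat) (M N : mfd R d)
    (f : mtype M -> mtype N) : Prop :=
  [/\ smooth_map f,
      exists g : mtype N -> mtype M,
        [/\ smooth_map g,
            forall x, mset M x -> g (f x) = x &
            forall y, mset N y -> f (g y) = y] &
      forall b c, matlas M b -> matlas N c ->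
        positive_on (cmap b @` (dom b `&` f @^-1` dom c))
                    (cmap c \o f \o cinv b)].

(* R^n x M *)
Definition euclidean_product (n d : nat) (M : mfd R d) : mfd R (n + d) :=
  @Mfd R (n + d) ('rV[R]_n * mtype M)%type
    (setT `*` mset M)
    [set Chart (setT `*` dom c)
               (fun p => row_mx p.1 (cmap c p.2))
               (fun v => (lsubmx v, cinv c (rsubmx v))) | c in matlas M].

(* A smooth action of T^n = R^n / Z^n, as an action of R^n trivial on Z^n. *)
Definition torus_action (n d : nat) (M : mfd R d)
    (act : 'rV[R]_n -> mtype M -> mtype M) : Prop :=
  [/\ forall s t x, mset M x -> act (s + t) x = act s (act t x),
      forall (z : 'rV[int]_n) x, mset M x -> act (map_mx intr z) x = x &
      @smooth_map (n + d) d (euclidean_product n M) M (fun p => act p.1 p.2)].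

(** * Null-cobordism of a closed oriented manifold *)

Definition cobordism_trivial (d : nat) (M : mfd R d) : Prop :=
  exists (W : mfd R (1 + d)) (f : mtype M -> mtype (boundary W)),
    compact_oriented_mfd (@halfspace d) W /\
    oriented_diffeomorphism f.

Definition torus_cobordism_trivial (n d : nat) (M : mfd R d)
    (act : 'rV[R]_n -> mtype M -> mtype M) : Prop :=
  exists (W : mfd R (1 + d)) (actW : 'rV[R]_n -> mtype W -> mtype W)
         (f : mtype M -> mtype (boundary W)),
    [/\ compact_oriented_mfd (@halfspace d) W,
        torus_action actW,
        oriented_diffeomorphism f &
        forall t x, mset M x -> f (act t x) = actW t (f x)].

End Manifolds.

(** * Hirzebruch surfaces *)

Section Hirzebruch.
Context {R : realType}.
Local Notation C := (R[i]^o).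

Definition nonzero : set (C * C) := [set z | z != 0].

(* L(k) is the quotient of (C^2 \ 0) x C by (z, u) ~ (l z, l^k u), l in C^*; its
   sections are the homogeneous functions of degree k, whence c_1 = k. So
   CP(L(k) + C) is the quotient of (C^2 \ 0)^2 by the relation below, where the
   two coordinates of [v.2] are those along L(k) and along the trivial line. *)
Definition hirz_rel (k : int) (v v' : nonzero * nonzero) : Prop :=
  exists l m : C, [/\ l != 0, m != 0,
    \val v'.1 = (l * (\val v.1).1, l * (\val v.1).2) &
    \val v'.2 = (m * l ^ k * (\val v.2).1, m * (\val v.2).2)].

Lemma hirz_rel_equiv k : equiv_class_of (fun v w => `[< hirz_rel k v w >]).
Proof.
split=> [[z w]|v v'|v' v v''].
- apply/asboolP; exists 1, 1; rewrite !oner_eq0 exp1rz !mul1r.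
  by split=> //=; rewrite ?mul1r -surjective_pairing.
- suff sym u u' : hirz_rel k u u' -> hirz_rel k u' u.
    by apply/asboolP/asboolP; exact: sym.
  move=> [l [m [l0 m0 e1 e2]]]; exists l^-1, m^-1; rewrite !invr_eq0; split=> //.
    by rewrite e1 /= !mulKf// -surjective_pairing.
  rewrite e2 /= mulKf// exprz_inv -invr_expz -invfM mulKf ?mulf_neq0 ?expfz_neq0//.
  by rewrite -surjective_pairing.
- move=> /asboolP[l [m [l0 m0 e1 e2]]] /asboolP[l' [m' [l0' m0' e1' e2']]].
  apply/asboolP; exists (l' * l), (m' * m); rewrite !mulf_neq0//; split=> //.
    by rewrite e1' e1 /= !mulrA.
  by rewrite e2' e2 /= exprzMl ?unitfE// !mulrA; congr (_ * _, _); ring.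
Qed.

Canonical hirz_equiv k := EquivRelPack (hirz_rel_equiv k).

Definition hirz_space (k : int) : topologicalType :=
  quotient_topology {eq_quot hirz_equiv k}.

Definition hirz_class (k : int) (v : nonzero * nonzero) : hirz_space k :=
  \pi_{eq_quot hirz_equiv k} v.


Definition entry (T : Type) (i : bool) (z : T * T) : T := if i then z.2 else z.1.

Lemma affine_point_subproof (i : bool) (u : C) :
  (if i then (u, 1) else (1, u) : C * C) \in nonzero.
Proof.
by rewrite mem_set//; case: i; apply/eqP => -[] *;
  exact: (elimN eqP (oner_neq0 R)).
Qed.

Definition affine_point (i : bool) (u : C) : nonzero :=
  SigSub (affine_point_subproof i u).

Definition realify (u v : C) : 'rV[R]_4 :=
  \row_i [:: complex.Re u; complex.Im u; complex.Re v; complex.Im v]`_i.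

Definition complexify (x : 'rV[R]_4) : C * C :=
  (Complex (x 0 0) (x 0 1), Complex (x 0 2) (x 0 3)).

(* Coordinates on the open set where the i-th coordinate in the base and the
   j-th one in the fibre do not vanish: the representative is rescaled so that
   these two coordinates become 1. *)
Definition hirz_dom (k : int) (i j : bool) : set (hirz_space k) :=
  [set q | entry i (\val (repr q).1) != 0 /\ entry j (\val (repr q).2) != 0].

Definition hirz_coord (k : int) (i j : bool) (q : hirz_space k) : 'rV[R]_4 :=
  let z := \val (repr q).1 in
  let w := ((entry i z) ^ (- k) * (\val (repr q).2).1, (\val (repr q).2).2) in
  realify (entry (~~ i) z / entry i z) (entry (~~ j) w / entry j w).

Definition hirz_param (k : int) (i j : bool) (x : 'rV[R]_4) : hirz_space k :=
  hirz_class k (affine_point i (complexify x).1, affine_point j (complexify x).2).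

(* With the orientation given by the complex structure. *)
Definition hirzebruch (k : int) : mfd R 4 :=
  @Mfd R 4 (hirz_space k) setT
    [set c | exists i j,
       c = Chart (@hirz_dom k i j) (@hirz_coord k i j) (@hirz_param k i j)].

Definition expi (a : R) : C := Complex (cos (2 * pi * a)) (sin (2 * pi * a)).

Lemma expi_neq0 a : expi a != 0.
Proof.
apply/eqP => -[c0 s0]; have := cos2Dsin2 (2 * pi * a).
by rewrite c0 s0 expr0n addr0 => /eqP; rewrite eq_sym oner_eq0.
Qed.

Lemma rotate_subproof (a b : C) (z : nonzero) : a != 0 -> b != 0 ->
  ((a * (\val z).1, b * (\val z).2) : C * C) \in nonzero.
Proof.
move=> a0 b0; rewrite mem_set//; case: z => -[z1 z2] /= /set_mem; apply: contra => /eqP[].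
move=> /eqP + /eqP; rewrite !mulf_eq0 (negbTE a0) (negbTE b0) /=.
by move=> /eqP -> /eqP ->.
Qed.

Definition rotate (a b : R) (z : nonzero) : nonzero :=
  SigSub (rotate_subproof z (expi_neq0 a) (expi_neq0 b)).

(* (t_1, t_2) . [z_0 : z_1, w_0 : w_1] = [z_0 : t_1 z_1, t_2 w_0 : w_1] *)
Definition hirz_action (k : int) (t : 'rV[R]_2) (q : hirz_space k) :
    hirz_space k :=
  hirz_class k (rotate 0 (t 0 0) (repr q).1, rotate (t 0 1) 0 (repr q).2).

End Hirzebruch.

(* Main.v *)
From HB Require Import structures.
Require Import Defs.
From mathcomp Require Import all_boot all_order all_algebra.
From mathcomp Require Import generic_quotient complex ring.
From mathcomp Require Import all_classical all_reals all_analysis.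

(** CP(L(k) + C) is the sphere bundle of L(k) + R over CP^1, so it bounds the
disc bundle, on which the torus still acts.  The 3-disc is taken in its projective
model: nonnegative nonzero Hermitian 2x2 matrices up to positive scalars, with
the matrices w w^* of rank 1, i.e. the points [w] of CP^1, as boundary.  A disc
minus a boundary point is then a half-space through (a, b, c) |-> (|w|^2 - a/c, w),
w = b/c, so the disc bundle has four half-space charts that extend the four
complex charts of the Hirzebruch surface.  Everything is realized inside R^10 by
rational formulas in homogeneous coordinates.  The transition maps are
compositions of a flip of the base and a flip of the fibre, both with an explicit
positive Jacobian determinant; orientations of the boundary follow since
the Jacobian matrix of a transition is block triangular along the boundary. *)

Set Implicit Arguments.
Unset Strict Implicit.
Unset Printing Implicit Defensive.

Import Order.TTheory GRing.Theory Num.Theory.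
Import numFieldNormedType.Exports.

Local Open Scope classical_set_scope.
Local Open Scope ring_scope.

(** * Elementary functions *)

(** The model is chosen for its boundary equation. The height [|w|^2 - a/c] is the determinant
    [a c - |b|^2] divided by [- c^2], so nonnegative forms fill a half-space, and a form [w w^*] has
    height 0 and the affine coordinate of the point [w]. Hence the inclusion of the surface reads
    [y |-> (0, y)] in matching charts. The forms are twisted: replacing z by l z multiplies [a],
    [b], [c] by |l|^(2k), l^k, 1. The ten coordinates are invariant under this and under rescaling
    of the form: four for the projector onto the line of z, two for the diagonal of the form, and
    [b] once against each entry of z, because neither of the two trivializations of L(k) is global.
    Inside R^10 the Hausdorff property is inherited, and compactness follows from a cover by four
    compact images. Two demands shape the rest. Smoothness at the boundary asks for extensions
    beyond the half-space, so every formula is studied on the open set where its denominators are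
    nonzero. Derivatives of all orders are required; a class of functions closed under
    differentiation yields them at once. *)

Section NearDifferentiable.
Context {R : numFieldType} {V W : normedModType R}.

(** [differentiable] speaks of the chosen differential ['d f x], so it cannot be transported along a
    local equality by rewriting. Here the zero map is a valid differential, and uniqueness
    identifies it with ['d f x]; a general local equality is reduced to this case through the
    difference of the two functions. *)
Lemma near0_differentiable (f : V -> W) (x : V) :
  (\near x, f x = 0) -> differentiable f x.
Proof.
move=> f0; pose z : {linear V -> W} := \0%R.
have zE : f \o shift x = cst (f x) + (z : V -> W) +o_ 0 id.
  have fx0 : f x = 0 by exact: nbhs_singleton f0.
  apply/eqaddoP => e e0; near=> h.
  rewrite !fctE /= fx0 add0r subr0.
  rewrite (_ : f (h + x) = 0) ?normr0 ?mulr_ge0 ?(ltW e0)//.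
  near: h; move: f0; rewrite (near_shift 0) subr0; exact: filterS.
have zC : continuous z by move=> y; exact: cvg_cst.
have dE := diff_unique zC zE.
by apply/diff_locallyP; rewrite dE.
Unshelve. all: by end_near. Qed.

Lemma near_eq_differentiable (f g : V -> W) (x : V) :
  (\near x, f x = g x) -> differentiable f x -> differentiable g x.
Proof.
move=> fg df; rewrite (_ : g = f + (g - f)); last by rewrite addrC subrK.
apply: differentiableD => //; apply: near0_differentiable.
by apply: filterS fg => y fgy; rewrite !fctE fgy subrr.
Qed.

End NearDifferentiable.

Section Elementary.
Context {R : realType}.

(** Membership makes smoothness a syntactic check, the class being stable under directional
    derivatives when [U] is open. [elementary_ext] lets only the values on [U] count, so total
    functions that differ outside [U] may be exchanged. Sine and cosine serve the torus action. *)
Inductive elementary {m : nat} (U : set 'rV[R]_m) : ('rV[R]_m -> R) -> Prop :=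
| elementary_cst c : elementary U (fun=> c)
| elementary_coord i : elementary U (fun x => x 0 i)
| elementaryD f g : elementary U f -> elementary U g ->
    elementary U (fun x => f x + g x)
| elementaryM f g : elementary U f -> elementary U g ->
    elementary U (fun x => f x * g x)
| elementaryV f : (forall x, U x -> f x != 0) -> elementary U f ->
    elementary U (fun x => (f x)^-1)
| elementary_sin f : elementary U f -> elementary U (fun x => sin (f x))
| elementary_cos f : elementary U f -> elementary U (fun x => cos (f x))
| elementary_ext f g : (forall x, U x -> f x = g x) -> elementary U f ->
    elementary U g.

Lemma elementaryN m (U : set 'rV[R]_m) f :
  elementary U f -> elementary U (fun x => - f x).
Proof.
move=> Uf; apply: (@elementary_ext _ _ (fun x => -1 * f x)) => [x _|].
  by rewrite mulN1r.
by apply: elementaryM => //; exact: elementary_cst.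
Qed.

Lemma elementaryB m (U : set 'rV[R]_m) f g :
  elementary U f -> elementary U g -> elementary U (fun x => f x - g x).
Proof. by move=> Uf Ug; apply: elementaryD => //; exact: elementaryN. Qed.

Lemma elementaryX m (U : set 'rV[R]_m) f n :
  elementary U f -> elementary U (fun x => f x ^+ n).
Proof.
move=> Uf; elim: n => [|n IHn].
  by apply: elementary_ext (elementary_cst _ 1) => x _; rewrite expr0.
by apply: elementary_ext (elementaryM Uf IHn) => x _; rewrite exprS.
Qed.

Lemma elementary_sub m (U V : set 'rV[R]_m) f : V `<=` U ->
  elementary U f -> elementary V f.
Proof.
move=> VU; elim=> {f}; try by [constructor].
- move=> f f0 _ Vf; apply: elementaryV => // x /VU; exact: f0.
- move=> f g fg _; apply: elementary_ext => x /VU; exact: fg.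
Qed.

Lemma elementary_comp m p (U : set 'rV[R]_m) (V : set 'rV[R]_p)
    (f : 'rV[R]_p -> R) (g : 'rV[R]_m -> 'rV[R]_p) :
  (forall x, U x -> V (g x)) -> (forall j, elementary U (fun x => g x 0 j)) ->
  elementary V f -> elementary U (f \o g).
Proof.
move=> UV Ug; elim=> {f}.
- by move=> c; exact: elementary_cst.
- by move=> i; exact: Ug.
- by move=> f h _ Uf _ Uh; exact: elementaryD.
- by move=> f h _ Uf _ Uh; exact: elementaryM.
- by move=> f f0 _ Uf; apply: elementaryV => // x /UV; exact: f0.
- by move=> f _; exact: elementary_sin.
- by move=> f _; exact: elementary_cos.
- by move=> f h fh _; apply: elementary_ext => x /UV; exact: fh.
Qed.

Lemma derive_comp1 (V : normedModType R) (f : V -> R) (h : R -> R) x v dh :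
  differentiable f x -> is_derive (f x) 1 h dh ->
  differentiable (h \o f) x /\ 'D_v (h \o f) x = 'D_v f x * dh.
Proof.
move=> df [hd <-]; have dh' : differentiable h (f x) by exact/derivable1_diffP.
have dhf : differentiable (h \o f) x by exact: differentiable_comp.
split=> //; rewrite !deriveE// diff_comp//=.
by rewrite -[X in 'd h _ X]mulr1 -[X in 'd h _ X]/('d f x v *: (1 : R)) linearZ.
Qed.

(** Both claims go through one induction because each derivative formula presupposes
    differentiability of the parts. Openness of [U] enters in the case of [elementary_ext]: equality
    on [U] is then equality near each of its points. *)
Lemma elementary_diff m (U : set 'rV[R]_m) (f : 'rV[R]_m -> R) :
  open U -> elementary U f ->
  (forall x, U x -> differentiable f x) /\
  forall v, elementary U (fun x => 'D_v f x).
Proof.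
move=> oU; elim=> {f}.
- move=> c; split=> [x _|v]; first exact: differentiable_cst.
  by apply: elementary_ext (elementary_cst _ 0) => x _; rewrite derive_cst.
- move=> i; split=> [x _|v]; first exact: differentiable_coord.
  apply: elementary_ext (elementary_cst _ (v 0 i)) => x _.
  rewrite deriveE; last exact: differentiable_coord.
  have lin : linear (fun x : 'rV[R]_m => x 0 i : R) by move=> a u w; rewrite !mxE.
  pose f : {linear 'rV[R]_m -> R} :=
    HB.pack (fun x : 'rV[R]_m => x 0 i) (GRing.isLinear.Build _ _ _ _ _ lin).
  have /(congr1 (@^~ v)) := diff_lin x (@coord_continuous R 1 m 0 i : continuous f).
  by move=> /esym; apply.
- move=> f g _ [df Df] _ [dg Dg]; split=> [x Ux|v].
    by apply: differentiableD; [exact: df|exact: dg].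
  apply: elementary_ext (elementaryD (Df v) (Dg v)) => x Ux.
  by rewrite -deriveD//; apply: diff_derivable; [exact: df|exact: dg].
- move=> f g Ef [df Df] Eg [dg Dg]; split=> [x Ux|v].
    by apply: differentiableM; [exact: df|exact: dg].
  apply: elementary_ext (elementaryD (elementaryM Ef (Dg v))
    (elementaryM Eg (Df v))) => x Ux.
  by rewrite -[RHS]/('D_v (f * g) x) deriveM//; apply: diff_derivable;
    [exact: df|exact: dg].
- move=> f f0 Ef [df Df]; split=> [x Ux|v].
    by apply: differentiableV; [exact: df|exact: f0].
  apply: elementary_ext (elementaryN (elementaryM
    (elementaryX 2 (elementaryV f0 Ef)) (Df v))) => x Ux.
  rewrite deriveV//; [|exact: f0|by apply: diff_derivable; exact: df].
  by rewrite exprVn scaleNr.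
- move=> f Ef [df Df]; split=> [x Ux|v].
    by apply: (derive_comp1 0 (df x Ux) (is_derive_sin (f x))).1.
  apply: elementary_ext (elementaryM (Df v) (elementary_cos Ef)) => x Ux.
  by rewrite (derive_comp1 v (df x Ux) (is_derive_sin (f x))).2.
- move=> f Ef [df Df]; split=> [x Ux|v].
    by apply: (derive_comp1 0 (df x Ux) (is_derive_cos (f x))).1.
  apply: elementary_ext (elementaryM (Df v) (elementaryN (elementary_sin Ef))) => x Ux.
  by rewrite (derive_comp1 v (df x Ux) (is_derive_cos (f x))).2.
- move=> f g fg _ [df Df].
  have nfg x : U x -> \near x, f x = g x.
    by move=> Ux; apply: filterS (open_nbhs_nbhs _) => [y|]; [exact: fg|].
  split=> [x Ux|v]; last first.
    by apply: elementary_ext (Df v) => x Ux; exact/near_eq_derive/nfg.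
  exact: near_eq_differentiable (nfg _ Ux) (df _ Ux).
Qed.

Definition elementary_rV m p (U : set 'rV[R]_m) (g : 'rV[R]_m -> 'rV[R]_p) :=
  forall j, elementary U (fun x => g x 0 j).

Lemma elementary_rV_comp m p q (U : set 'rV[R]_m) (V : set 'rV[R]_p)
    (f : 'rV[R]_p -> 'rV[R]_q) (g : 'rV[R]_m -> 'rV[R]_p) :
  (forall x, U x -> V (g x)) -> elementary_rV U g -> elementary_rV V f ->
  elementary_rV U (f \o g).
Proof. by move=> UV Ug Vf j; apply: elementary_comp UV Ug (Vf j). Qed.

Lemma elementary_rV_ext m p (U : set 'rV[R]_m) (f g : 'rV[R]_m -> 'rV[R]_p) :
  (forall x, U x -> f x = g x) -> elementary_rV U f -> elementary_rV U g.
Proof.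
by move=> fg Uf j; apply: elementary_ext (Uf j) => x Ux; rewrite fg.
Qed.

Lemma differentiable_rV m p (g : 'rV[R]_m -> 'rV[R]_p) x :
  (forall j, differentiable (fun x => g x 0 j) x) -> differentiable g x.
Proof.
move=> dg; rewrite (_ : g = \sum_j (fun y => g y 0 j *: delta_mx 0 j)).
  by apply: differentiable_sum => j; exact: differentiableZl.
by apply/funext => y; rewrite {1}[g y]row_sum_delta fct_sumE.
Qed.

Lemma elementary_differentiable m p (U : set 'rV[R]_m)
    (g : 'rV[R]_m -> 'rV[R]_p) x :
  open U -> elementary_rV U g -> U x -> differentiable g x.
Proof.
move=> oU Ug Ux; apply: differentiable_rV => j.
exact: (elementary_diff oU (Ug j)).1.
Qed.

Lemma elementary_continuous m p (U : set 'rV[R]_m)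
    (g : 'rV[R]_m -> 'rV[R]_p) x :
  open U -> elementary_rV U g -> U x -> {for x, continuous g}.
Proof.
move=> oU Ug Ux; apply: differentiable_continuous.
exact: elementary_differentiable Ux.
Qed.

Lemma derive_coord m p (g : 'rV[R]_m -> 'rV[R]_p) x v j :
  differentiable g x -> 'D_v g x 0 j = 'D_v (fun y => g y 0 j) x.
Proof.
by move=> dg; rewrite derive_mx ?mxE//; exact: diff_derivable.
Qed.

(** The induction on [r] closes because the partial derivatives of [g] have elementary entries
    again. *)
Lemma elementary_Cr m p (U : set 'rV[R]_m) (g : 'rV[R]_m -> 'rV[R]_p) r :
  open U -> elementary_rV U g -> Cr r g U.
Proof.
move=> oU; elim: r g => [|r IHr] g Ug /=.
  by move=> x; exact: elementary_continuous Ug.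
split=> [x|i]; first exact: elementary_differentiable Ug.
apply: IHr => j; apply: elementary_ext ((elementary_diff oU (Ug j)).2 (delta_mx 0 i)) => x Ux.
by rewrite derive_coord//; exact: elementary_differentiable Ug Ux.
Qed.

(** One extension on one open set serves all points of [S]. For charts with boundary, [S] lies in
    the half-space while [U] reaches beyond it. *)
Lemma elementary_smooth_on m p (S U : set 'rV[R]_m) (f g : 'rV[R]_m -> 'rV[R]_p) :
  open U -> S `<=` U -> elementary_rV U g -> (forall x, S x -> g x = f x) ->
  smooth_on S f.
Proof.
move=> oU SU Ug gf x Sx; exists U, g; split=> //; first exact: SU.
  by move=> r; exact: elementary_Cr.
by move=> y _; exact: gf.
Qed.

End Elementary.

(** * Jacobian determinants *)

Section Jacobian.
Context {R : realType}.

Lemma jacobian_comp m p q (f : 'rV[R]_m -> 'rV[R]_p) (g : 'rV[R]_p -> 'rV[R]_q) x :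
  differentiable f x -> differentiable g (f x) ->
  'J (g \o f) x = 'J f x *m 'J g (f x).
Proof.
move=> df dg; apply/row_matrixP => i; rewrite !rowE mulmxA /jacobian.
by rewrite !mul_rV_lin1 diff_comp.
Qed.

Lemma jacobianE m p (f : 'rV[R]_m -> 'rV[R]_p) x i j :
  differentiable f x -> 'J f x i j = 'D_(delta_mx 0 i) (fun y => f y 0 j) x.
Proof.
by move=> df; rewrite -(derive_coord _ _ df) (deriveEjacobian _ df) -rowE [RHS]mxE.
Qed.

Lemma near_eq_jacobian m p (f g : 'rV[R]_m -> 'rV[R]_p) x :
  differentiable f x -> (\near x, f x = g x) -> 'J f x = 'J g x.
Proof.
move=> df fg; have dg := near_eq_differentiable fg df.
suff dE : ('d f x : 'rV[R]_m -> 'rV[R]_p) = 'd g x.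
  exact: (congr1 (@lin1_mx _ _ _) dE).
apply/funext => v.
exact: etrans (esym (deriveE v df)) (etrans (near_eq_derive v fg) (deriveE v dg)).
Qed.

(** Most Jacobian entries below belong to functions that are affine along the coordinate line in
    question; their difference quotient is constant. *)
Lemma derive_affine m (f : 'rV[R]_m -> R) x v c :
  (forall h, f (h *: v + x) = f x + h * c) -> 'D_v f x = c.
Proof.
move=> fh; rewrite /derive; apply: cvg_lim => //.
apply: (@cvg_trans _ (cst c @ 0^')); last exact: cvg_cst.
apply: near_eq_cvg; near=> h => /=.
have h0 : h != 0 by near: h; exact: nbhs_dnbhs_neq.
by rewrite fh addrAC subrr add0r -[_ *: _]/(_ * _) mulKf.
Unshelve. all: by end_near. Qed.

Definition positive_at m (f : 'rV[R]_m -> 'rV[R]_m) x :=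
  differentiable f x /\ 0 < \det ('J f x).

Lemma positive_at_comp m (f g : 'rV[R]_m -> 'rV[R]_m) x :
  positive_at f x -> positive_at g (f x) -> positive_at (g \o f) x.
Proof.
move=> [df Jf] [dg Jg]; split; first exact: differentiable_comp df dg.
rewrite (jacobian_comp df dg) det_mulmx; exact: mulr_gt0 Jf Jg.
Qed.

Lemma positive_at_near m (f g : 'rV[R]_m -> 'rV[R]_m) x :
  (\near x, f x = g x) -> positive_at f x -> positive_at g x.
Proof.
move=> fg [df Jf]; split; first exact: near_eq_differentiable fg df.
rewrite -(near_eq_jacobian df fg); exact: Jf.
Qed.

(** At an interior point of [S] the two maps agree in a full neighbourhood, so the Jacobian of [f]
    is that of [g]. *)
Lemma positive_onP m (S U : set 'rV[R]_m) (f g : 'rV[R]_m -> 'rV[R]_m) :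
  S `<=` U -> (forall x, U x -> positive_at g x) ->
  (forall x, S x -> g x = f x) -> positive_on S f.
Proof.
move=> SU Ug gf x Sx; have nS : \near x, S x by exact: Sx.
have fg : \near x, g x = f x by apply: filterS nS.
exact: (positive_at_near fg (Ug _ (SU _ (interior_subset Sx)))).2.
Qed.

Lemma det_mx2 (A : 'M[R]_2) : \det A = A 0 0 * A 1 1 - A 0 1 * A 1 0.
Proof.
rewrite (expand_det_row _ 0) !big_ord_recl big_ord0 addr0 /cofactor !det_mx11.
rewrite !mxE /= !expr0 !mul1r expr1 mulN1r mulrN.
by congr (A _ _ * A _ _ - A _ _ * A _ _); apply/val_inj.
Qed.

(* Rows 0, (1, 2), (3, 4) are the derivatives along the three complex (or real)
   coordinates; the second output coordinate depends only on itself. *)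
Lemma det_mx5_lower (A : 'M[R]_5) :
  (forall i j : 'I_5, i = 0%N :> nat -> (0 < j)%N -> A i j = 0) ->
  (forall i j : 'I_5, (3 <= i)%N -> (0 < j < 3)%N -> A i j = 0) ->
  \det A = A 0 0 * (A 1 1 * A 2 2 - A 1 2 * A 2 1)
                 * (A 3 3 * A 4 4 - A 3 4 * A 4 3).
Proof.
move=> A0 A3; have E5 := congr1 (@determinant R (1 + 4)) (@submxK R 1 4 1 4 A).
have E4 := congr1 (@determinant R (2 + 2)) (@submxK R 2 2 2 2 (drsubmx (A : 'M[R]_(1 + 4, 1 + 4)))).
rewrite -[LHS]/(@determinant R (1 + 4) A) -{}E5.
have -> : @ursubmx R 1 4 1 4 A = 0.
  by apply/matrixP => i j; rewrite !mxE A0//; case: i => -[].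
rewrite det_lblock -[X in _ * X]/(@determinant R (2 + 2) _) -{}E4.
have -> : @dlsubmx R 2 2 2 2 (drsubmx (A : 'M[R]_(1 + 4, 1 + 4))) = 0.
  by apply/matrixP => i j; rewrite !mxE A3//=; case: j => -[|[]].
rewrite det_ublock det_mx11 !det_mx2 !mxE mulrA.
by congr (A _ _ * (A _ _ * A _ _ - A _ _ * A _ _) * (A _ _ * A _ _ - A _ _ * A _ _));
  apply/val_inj.
Qed.

(** For maps whose height depends on the height alone, as for [inversion]; [det_mx5_lower] suits
    maps in which the height influences nothing but the height. *)
Lemma det_mx5_upper (A : 'M[R]_5) :
  (forall i j : 'I_5, (0 < i)%N -> j = 0%N :> nat -> A i j = 0) ->
  (forall i j : 'I_5, (3 <= i)%N -> (0 < j < 3)%N -> A i j = 0) ->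
  \det A = A 0 0 * (A 1 1 * A 2 2 - A 1 2 * A 2 1)
                 * (A 3 3 * A 4 4 - A 3 4 * A 4 3).
Proof.
move=> A0 A3; have E5 := congr1 (@determinant R (1 + 4)) (@submxK R 1 4 1 4 A).
have E4 := congr1 (@determinant R (2 + 2)) (@submxK R 2 2 2 2 (drsubmx (A : 'M[R]_(1 + 4, 1 + 4)))).
rewrite -[LHS]/(@determinant R (1 + 4) A) -{}E5.
have -> : @dlsubmx R 1 4 1 4 A = 0.
  by apply/matrixP => i j; rewrite !mxE A0//; case: j => -[].
rewrite det_ublock -[X in _ * X]/(@determinant R (2 + 2) _) -{}E4.
have -> : @dlsubmx R 2 2 2 2 (drsubmx (A : 'M[R]_(1 + 4, 1 + 4))) = 0.
  by apply/matrixP => i j; rewrite !mxE A3//=; case: j => -[|[]].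
rewrite det_ublock det_mx11 !det_mx2 !mxE mulrA.
by congr (A _ _ * (A _ _ * A _ _ - A _ _ * A _ _) * (A _ _ * A _ _ - A _ _ * A _ _));
  apply/val_inj.
Qed.

End Jacobian.

(** * Complex-valued elementary functions *)

Section ComplexElementary.
Context {R : realType}.
Local Notation C := (R[i]^o).
Local Open Scope complex_scope.

Definition nrm2 (u : C) : R := complex.Re u ^+ 2 + complex.Im u ^+ 2.

Lemma nrm2_ge0 u : 0 <= nrm2 u.
Proof. by rewrite addr_ge0 ?sqr_ge0. Qed.

Lemma nrm2_eq0 u : (nrm2 u == 0) = (u == 0).
Proof. by rewrite paddr_eq0 ?sqr_ge0// !sqrf_eq0 eq_complex. Qed.

Lemma nrm2_gt0 u : (0 < nrm2 u) = (u != 0).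
Proof. by rewrite lt_def nrm2_ge0 andbT nrm2_eq0. Qed.

Lemma nrm2M u v : nrm2 (u * v) = nrm2 u * nrm2 v.
Proof. by case: u v => [a b] [c d]; rewrite /nrm2 /=; ring. Qed.

Lemma nrm21 : nrm2 1 = 1.
Proof. by rewrite /nrm2 /= expr0n expr1n addr0. Qed.

Lemma nrm20 : nrm2 0 = 0.
Proof. by rewrite /nrm2 /= expr0n addr0. Qed.

Lemma nrm2_conj u : nrm2 (conjc u : C) = nrm2 u.
Proof. by case: u => a b; rewrite /nrm2 /= sqrrN. Qed.

Lemma nrm2_real (a : R) : nrm2 (a%:C : C) = a ^+ 2.
Proof. by rewrite /nrm2 /= expr0n addr0. Qed.

Lemma conjcM (u v : C) : conjc (u * v) = conjc u * conjc v :> C.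
Proof. exact: rmorphM. Qed.

Lemma conjcXz (u : C) (k : int) : conjc (u ^ k) = (conjc u : C) ^ k :> C.
Proof.
case: k => n; first exact: rmorphXn.
by rewrite NegzE -!exprnN (conjc_inv (u ^+ n.+1)); congr (_^-1); exact: rmorphXn.
Qed.

Lemma nrm2E u : (nrm2 u)%:C = u * conjc u :> C.
Proof.
by case: u => a b; apply/eqP; rewrite eq_complex /nrm2 /=; apply/andP; split;
  apply/eqP; ring.
Qed.

Lemma nrm2V u : nrm2 u^-1 = (nrm2 u)^-1.
Proof.
have [->|u0] := eqVneq u 0; first by rewrite invr0 nrm20 invr0.
by apply: (mulIf (_ : nrm2 u != 0)); rewrite ?nrm2_eq0// -nrm2M !mulVf ?nrm21 ?nrm2_eq0.
Qed.

Lemma nrm2X u n : nrm2 (u ^+ n) = nrm2 u ^+ n.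
Proof. by elim: n => [|n IHn]; rewrite ?expr0 ?nrm21// !exprS nrm2M IHn. Qed.

Lemma nrm2Xz u (k : int) : nrm2 (u ^ k) = nrm2 u ^ k.
Proof. by case: k => n; rewrite ?NegzE -?exprnN ?nrm2V nrm2X. Qed.

Lemma invc_nrm2 u : u^-1 = conjc u * ((nrm2 u)^-1)%:C :> C.
Proof.
have [->|u0] := eqVneq u 0; first by rewrite invr0 conjc0 mul0r.
apply: (mulfI u0); rewrite mulfV// mulrA -nrm2E -rmorphM mulfV ?rmorph1//.
by rewrite nrm2_eq0.
Qed.

Lemma Re_inv u : complex.Re u^-1 = complex.Re u / nrm2 u.
Proof. by case: u. Qed.

Lemma Im_inv u : complex.Im u^-1 = - complex.Im u / nrm2 u.
Proof. by case: u => a b; rewrite mulNr. Qed.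

Definition elementaryC m (U : set 'rV[R]_m) (h : 'rV[R]_m -> C) :=
  elementary U (fun x => complex.Re (h x)) /\
  elementary U (fun x => complex.Im (h x)).

Section Rules.
Context {m : nat} {U : set 'rV[R]_m}.
Implicit Types f g : 'rV[R]_m -> C.

Lemma elementaryC_ext f g : (forall x, U x -> f x = g x) ->
  elementaryC U f -> elementaryC U g.
Proof.
move=> fg [Rf If]; split; [move: Rf|move: If].
  by apply: elementary_ext => x Ux; rewrite fg.
by apply: elementary_ext => x Ux; rewrite fg.
Qed.

Lemma elementaryC_cst c : elementaryC U (fun=> c).
Proof. by split; exact: elementary_cst. Qed.

Lemma elementaryC_real (a : 'rV[R]_m -> R) :
  elementary U a -> elementaryC U (fun x => (a x)%:C).
Proof. by move=> Ua; split => //; exact: elementary_cst. Qed.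

Lemma elementaryCM f g : elementaryC U f -> elementaryC U g ->
  elementaryC U (fun x => f x * g x).
Proof.
move=> [Rf If] [Rg Ig]; split.
  apply: elementary_ext (elementaryB (elementaryM Rf Rg) (elementaryM If Ig)) => x _.
  by case: (f x) (g x) => [a b] [c d].
apply: elementary_ext (elementaryD (elementaryM Rf Ig) (elementaryM If Rg)) => x _.
by case: (f x) (g x) => [a b] [c d].
Qed.

Lemma elementaryC_conj f : elementaryC U f -> elementaryC U (fun x => conjc (f x)).
Proof.
move=> [Rf If]; split.
  by apply: elementary_ext Rf => x _; case: (f x).
by apply: elementary_ext (elementaryN If) => x _; case: (f x).
Qed.

Lemma elementary_nrm2 f : elementaryC U f -> elementary U (fun x => nrm2 (f x)).
Proof. by move=> [Rf If]; exact: elementaryD (elementaryX 2 Rf) (elementaryX 2 If). Qed.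

Lemma elementaryCV f : (forall x, U x -> f x != 0) -> elementaryC U f ->
  elementaryC U (fun x => (f x)^-1).
Proof.
move=> f0 Uf; apply: (@elementaryC_ext (fun x => conjc (f x) * ((nrm2 (f x))^-1)%:C)).
  by move=> x _; rewrite -invc_nrm2.
apply: elementaryCM; first exact: elementaryC_conj.
apply: elementaryC_real; apply: elementaryV; last exact: elementary_nrm2.
by move=> x /f0; rewrite nrm2_eq0.
Qed.

Lemma elementaryCX f n : elementaryC U f -> elementaryC U (fun x => f x ^+ n).
Proof.
move=> Uf; elim: n => [|n IHn].
  by apply: elementaryC_ext (elementaryC_cst 1) => x _; rewrite expr0.
by apply: elementaryC_ext (elementaryCM Uf IHn) => x _; rewrite exprS.
Qed.

Lemma elementaryCXz f (k : int) : (forall x, U x -> f x != 0) ->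
  elementaryC U f -> elementaryC U (fun x => f x ^ k).
Proof.
move=> f0 Uf; case: k => n; first exact: elementaryCX.
apply: elementaryCV (elementaryCX n.+1 Uf) => x /f0; exact: expf_neq0.
Qed.

Lemma elementaryXz (f : 'rV[R]_m -> R) (k : int) : (forall x, U x -> f x != 0) ->
  elementary U f -> elementary U (fun x => f x ^ k).
Proof.
move=> f0 Uf; case: k => n; first exact: elementaryX.
apply: elementaryV (elementaryX n.+1 Uf) => x /f0; exact: expf_neq0.
Qed.

End Rules.

(* [u ^ (- k) * |u| ^ (2 |k|)], as a polynomial in [u] and its conjugate *)
Definition hpow (k : int) (u : C) : C :=
  match k with
  | Posz n => conjc u ^+ n
  | Negz n => u ^+ n.+1 * (nrm2 u ^+ n.+1)%:C
  end.

Lemma hpowE k u : u != 0 -> hpow k u = u ^ (- k) * (nrm2 u ^+ `|k|%N)%:C.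
Proof.
move=> u0; case: k => n /=; last by rewrite NegzE opprK.
by rewrite -exprnN rmorphXn/= nrm2E exprMn mulKf// expf_neq0.
Qed.

(** In contrast to [u ^ (- k)], this holds across the zeros of [f], so the embedding is smooth where
    an entry of z vanishes. *)
Lemma elementary_hpow m (U : set 'rV[R]_m) k (f : 'rV[R]_m -> C) :
  elementaryC U f -> elementaryC U (fun x => hpow k (f x)).
Proof.
move=> Uf; case: k => n; first exact: elementaryCX (elementaryC_conj Uf).
apply: elementaryCM; first exact: elementaryCX.
by apply: elementaryC_real; apply: elementaryX; exact: elementary_nrm2.
Qed.

Lemma hpowM k u v : hpow k (u * v) = hpow k u * hpow k v.
Proof.
case: k => n /=; first by rewrite rmorphM exprMn.
by rewrite nrm2M !exprMn rmorphM/= mulrACA.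
Qed.

End ComplexElementary.

(** * The disc bundle in homogeneous coordinates *)

Section Embedding.
Context {R : realType}.
Local Notation C := (R[i]^o).
Local Open Scope complex_scope.

Definition row5 (h : R) (u v : C) : 'rV[R]_(1 + 4) :=
  row_mx (const_mx h) (realify u v).
Definition height (x : 'rV[R]_(1 + 4)) : R := x 0 0.
Definition base (x : 'rV[R]_(1 + 4)) : C := (complexify (rsubmx x)).1.
Definition fibre (x : 'rV[R]_(1 + 4)) : C := (complexify (rsubmx x)).2.

Lemma complexify_realify (u v : C) : complexify (realify u v) = (u, v).
Proof. by case: u v => [a b] [c d]; rewrite /complexify /realify !mxE. Qed.

Lemma realify_complexify (x : 'rV[R]_4) :
  realify (complexify x).1 (complexify x).2 = x.
Proof.
apply/rowP => -[[|[|[|[|//]]]] i]; rewrite /realify /complexify !mxE /=;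
  by congr (x _ _); apply/val_inj.
Qed.

Lemma height_row5 h u v : height (row5 h u v) = h.
Proof.
rewrite /height (_ : row5 h u v 0 0 = row5 h u v 0 (lshift 4 0)).
  by rewrite /row5 row_mxEl mxE.
by congr (_ _ _); apply/val_inj.
Qed.

Lemma base_row5 h u v : base (row5 h u v) = u.
Proof. by rewrite /base /row5 row_mxKr complexify_realify. Qed.

Lemma fibre_row5 h u v : fibre (row5 h u v) = v.
Proof. by rewrite /fibre /row5 row_mxKr complexify_realify. Qed.

Lemma row5K x : row5 (height x) (base x) (fibre x) = x.
Proof.
rewrite /row5 realify_complexify -[RHS]hsubmxK; congr row_mx.
by apply/rowP => i; rewrite !mxE /height ord1; congr (x _ _); apply/val_inj.
Qed.

Definition rowE5 := (height_row5, base_row5, fibre_row5).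

Definition hsize (z : C * C) : R := nrm2 z.1 + nrm2 z.2.

Definition affine (i : bool) (u : C) : C * C := if i then (u, 1) else (1, u).

Lemma hsize_eq0 z : (hsize z == 0) = (z == 0).
Proof.
case: z => u v; rewrite paddr_eq0 ?nrm2_ge0// !nrm2_eq0.
by apply/andP/eqP => [[/eqP/= -> /eqP/= ->]//|[-> ->]].
Qed.

Lemma hsize_gt0 z : z != 0 -> 0 < hsize z.
Proof. by move=> z0; rewrite lt_def hsize_eq0 z0 addr_ge0// nrm2_ge0. Qed.

Lemma hsize_affine i u : hsize (affine i u) = 1 + nrm2 u.
Proof. by case: i; rewrite /hsize /= nrm21// addrC. Qed.

Lemma affine_neq0 i u : hsize (affine i u) != 0.
Proof. by rewrite hsize_affine gt_eqF// ltr_pwDl// nrm2_ge0. Qed.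

Lemma entry_affine i u : entry i (affine i u) = 1.
Proof. by case: i. Qed.

Lemma entryN_affine i u : entry (~~ i) (affine i u) = u.
Proof. by case: i. Qed.

Context (k : int).

(** The trace of the form for the metric [hsize z ^ (- k)] on L(k). Dividing by it removes the
    freedom of rescaling the form. *)
Definition weight (z : C * C) (a c : R) : R := a * hsize z ^ (- k) + c.

(* [a, b, c] are the entries of a Hermitian form on the fibre over [z]; the
   fibres of the disc bundle are the classes of nonnegative forms up to positive
   scalars, and the forms of rank 1 make up the boundary. *)
Definition embed (z : C * C) (a : R) (b : C) (c : R) : 'rV[R]_10 :=
  \row_n [:: nrm2 z.1 / hsize z; nrm2 z.2 / hsize z;
             complex.Re (z.2 * conjc z.1) / hsize z;
             complex.Im (z.2 * conjc z.1) / hsize z;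
             a * hsize z ^ (- k) / weight z a c; c / weight z a c;
             complex.Re (b * hpow k z.1) / (hsize z ^+ `|k|%N * weight z a c);
             complex.Im (b * hpow k z.1) / (hsize z ^+ `|k|%N * weight z a c);
             complex.Re (b * hpow k z.2) / (hsize z ^+ `|k|%N * weight z a c);
             complex.Im (b * hpow k z.2) / (hsize z ^+ `|k|%N * weight z a c)]`_n.

(** In each entry numerator and denominator acquire the same factor: [nrm2 l] for the base, [m] for
    the diagonal of the form, and [m * nrm2 l ^+ |k|] for the products with [b], since the factor
    [l ^ k] of [b] cancels against the one in [hpow k l]. *)
Lemma embed_scale (l : C) (m : R) z a b c : l != 0 -> m != 0 -> hsize z != 0 ->
  embed (l * z.1, l * z.2) (m * nrm2 l ^ k * a) (m%:C * l ^ k * b) (m * c) =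
  embed z a b c.
Proof.
move=> l0 m0 z0.
have n0 : nrm2 l != 0 by rewrite nrm2_eq0.
have hs : hsize (l * z.1, l * z.2) = nrm2 l * hsize z.
  by rewrite /hsize /= !nrm2M -mulrDr.
have nk : nrm2 l ^ k * nrm2 l ^ (- k) = 1 by rewrite -expfzDr// subrr expr0z.
have wE : weight (l * z.1, l * z.2) (m * nrm2 l ^ k * a) (m * c) = m * weight z a c.
  rewrite /weight hs expfzMl mulrDr; congr (_ + _).
  rewrite -[RHS]mul1r -nk; move: (nrm2 l ^ k) (nrm2 l ^ - k) (hsize z ^ _) => P Q S.
  by ring.
have b1 u : complex.Re (m%:C * l ^ k * b * hpow k (l * u)) =
    m * nrm2 l ^+ `|k| * complex.Re (b * hpow k u) /\
  complex.Im (m%:C * l ^ k * b * hpow k (l * u)) =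
    m * nrm2 l ^+ `|k| * complex.Im (b * hpow k u).
  have -> : m%:C * l ^ k * b * hpow k (l * u) =
      (m * nrm2 l ^+ `|k|)%:C * (b * hpow k u).
    rewrite hpowM (hpowE _ l0) rmorphM/=.
    have lk : l ^ k * l ^ (- k) = 1 by rewrite -expfzDr// subrr expr0z.
    rewrite -[RHS]mul1r -lk; move: (l ^ k) (l ^ - k) => P Q.
    by set X := (nrm2 l ^+ _)%:C; ring.
  by case: (b * _) => x y /=; rewrite !mul0r subr0 addr0.
have na : nrm2 l ^+ `|k| != 0 by rewrite expf_neq0.
have sc (x y q : R) : q != 0 -> q * x / (q * y) = x / y.
  by move=> q0; rewrite -mulf_div divff// mul1r.
apply/rowP => n; rewrite !mxE /= wE hs !nrm2M !(b1 _).1 !(b1 _).2 exprMn.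
have -> : l * z.2 * conjc (l * z.1) = (nrm2 l)%:C * (z.2 * conjc z.1).
  by rewrite nrm2E rmorphM/=; ring.
have -> : m * nrm2 l ^ k * a * (nrm2 l * hsize z) ^ (- k) = m * (a * hsize z ^ (- k)).
  rewrite expfzMl -[RHS]mul1r -nk; move: (nrm2 l ^ k) (nrm2 l ^ - k) (hsize z ^ _) => P Q S.
  by ring.
have -> : nrm2 l ^+ `|k| * hsize z ^+ `|k| * (m * weight z a c) =
   (m * nrm2 l ^+ `|k|) * (hsize z ^+ `|k| * weight z a c) by ring.
have mn0 : m * nrm2 l ^+ `|k| != 0 by rewrite mulf_neq0.
rewrite !(sc _ _ m)// !(sc _ _ _ mn0) !(sc _ _ _ n0).
case: (z.2 * conjc z.1) => x y /=; rewrite !mul0r subr0 addr0 !(sc _ _ _ n0).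
by case: n => -[|[|[|[|[|[|[|[|[|[|//]]]]]]]]]].
Qed.

End Embedding.

(** * Four half-space charts, their inverses, and the two flips relating them *)

Section Charts.
Context {R : realType}.
Local Notation C := (R[i]^o).
Local Open Scope complex_scope.

(** On the form [w w^*], whose entries are [nrm2 w.1], [w.1 * conjc w.2], [nrm2 w.2], this is the
    affine coordinate [w.1 / w.2] for [j = true] and [w.2 / w.1] for [j = false]. *)
Definition fib_w (j : bool) (a : R) (b : C) (c : R) : C :=
  if j then b * (c^-1)%:C else conjc b * (a^-1)%:C.

Definition fib_s (j : bool) (a c : R) : R := if j then a / c else c / a.

(** The height is minus the determinant [a c - |b|^2] of the form over the square of its diagonal
    entry selected by [j]. *)
Definition point5 (j : bool) (u : C) (a : R) (b : C) (c : R) : 'rV[R]_(1 + 4) :=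
  row5 (nrm2 (fib_w j a b c) - fib_s j a c) u (fib_w j a b c).

Lemma point5_scale j u m a b c : m != 0 ->
  point5 j u (m * a) (m%:C * b) (m * c) = point5 j u a b c.
Proof.
move=> m0; have mV x : m%:C * ((m * x)^-1)%:C = (x^-1)%:C :> C.
  by rewrite -rmorphM invfM mulVKf.
rewrite /point5 /fib_w /fib_s; case: j.
  by rewrite -mulf_div divff// mul1r mulrAC mV [_ * b]mulrC.
by rewrite -mulf_div divff// mul1r conjcM conjc_real mulrAC mV [_ * conjc b]mulrC.
Qed.

Lemma point5_halfspace j u a b c : 0 <= a -> 0 <= c -> nrm2 b <= a * c ->
  halfspace (point5 j u a b c).
Proof.
move=> a0 c0 bac; rewrite /halfspace /= -[X in X <= 0]/(height _) height_row5.
rewrite subr_le0 /fib_w /fib_s; case: j; rewrite nrm2M nrm2_real ?nrm2_conj exprVn.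
  (* When the denominator vanishes, the convention for inverses makes both sides 0. *)
  have [->|c1] := eqVneq c 0; first by rewrite expr0n invr0 !mulr0.
  rewrite ler_pdivrMr ?exprn_even_gt0// expr2 mulrA divfK//.
have [->|a1] := eqVneq a 0; first by rewrite expr0n invr0 !mulr0.
by rewrite ler_pdivrMr ?exprn_even_gt0// expr2 mulrA divfK// mulrC.
Qed.

Definition pnorm (i : bool) (p : 'rV[R]_10) : R := p 0 (if i then 1 else 0).
(** The embedding stores only [z.2 * conjc z.1]; the chart with [z.2] as denominator needs its
    conjugate, whence the sign. *)
Definition pbase (i : bool) (p : 'rV[R]_10) : C :=
  if i then Complex (p 0 2) (- p 0 3) else Complex (p 0 2) (p 0 3).
Definition pfib (i : bool) (p : 'rV[R]_10) : C :=
  if i then Complex (p 0 8) (p 0 9) else Complex (p 0 6) (p 0 7).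
Definition pdiag (j : bool) (p : 'rV[R]_10) : R := p 0 (if j then 5 else 4).

Context (k : int).

(** The powers of [pnorm i p] trade the normalization by [hsize z] for the one with [entry i z = 1].
    What results are the entries of the form in that trivialization, all divided by [weight], a
    factor to which [point5] is blind. *)
Definition chart_map (i j : bool) (p : 'rV[R]_10) : 'rV[R]_(1 + 4) :=
  point5 j (pbase i p * ((pnorm i p)^-1)%:C) (pdiag false p * pnorm i p ^ (- k))
    (pfib i p * (pnorm i p ^- `|k|%N)%:C) (pdiag true p).

Definition chart_inv (i j : bool) (x : 'rV[R]_(1 + 4)) : 'rV[R]_10 :=
  let s := nrm2 (fibre x) - height x in
  embed k (affine i (base x)) (if j then s else 1)
    (if j then fibre x else conjc (fibre x)) (if j then 1 else s).

Definition chart_open (i j : bool) (p : 'rV[R]_10) : Prop :=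
  pnorm i p != 0 /\ pdiag j p != 0.

Lemma pnorm_embed i z a b c : pnorm i (embed k z a b c) = nrm2 (entry i z) / hsize z.
Proof. by case: i; rewrite /pnorm mxE. Qed.

Lemma pdiag_embed j z a b c : pdiag j (embed k z a b c) =
  (if j then c else a * hsize z ^ (- k)) / weight k z a c.
Proof. by case: j; rewrite /pdiag mxE. Qed.

Lemma pbase_embed i z a b c : pbase i (embed k z a b c) =
  entry (~~ i) z * conjc (entry i z) * ((hsize z)^-1)%:C.
Proof.
case: i; rewrite /pbase !mxE /=; case: z => -[x1 y1] [x2 y2]; apply/eqP;
  by rewrite eq_complex /=; apply/andP; split; apply/eqP; ring.
Qed.

Lemma pfib_embed i z a b c : pfib i (embed k z a b c) =
  b * hpow k (entry i z) * ((hsize z ^+ `|k|%N * weight k z a c)^-1)%:C.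
Proof.
by case: i; rewrite /pfib !mxE /=; case: (b * _) => x y; apply/eqP;
  rewrite eq_complex /=; apply/andP; split; apply/eqP; ring.
Qed.

Lemma chart_map_embed i j z a b c :
  hsize z != 0 -> weight k z a c != 0 -> entry i z != 0 ->
  chart_map i j (embed k z a b c) =
  point5 j (entry (~~ i) z / entry i z) (a * nrm2 (entry i z) ^ (- k))
    (b * entry i z ^ (- k)) c.
Proof.
move=> z0 t0 zi0; rewrite /chart_map pbase_embed pnorm_embed pfib_embed !pdiag_embed.
set n := nrm2 (entry i z); have n0 : n != 0 by rewrite nrm2_eq0.
have -> : entry (~~ i) z * conjc (entry i z) * ((hsize z)^-1)%:C *
   ((n / hsize z)^-1)%:C = entry (~~ i) z / entry i z.
  rewrite invf_div -!mulrA; congr (_ * _); rewrite -rmorphM mulKf//.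
  by rewrite [RHS]invc_nrm2.
(* The common factor left over from the normalization of the form is introduced on the right. *)
rewrite -[RHS](@point5_scale _ _ (weight k z a c)^-1) ?invr_eq0//; congr point5.
- rewrite expfzMl exprz_inv opprK.
  have hk : hsize z ^ (- k) * hsize z ^ k = 1 by rewrite -expfzDr// addNr expr0z.
  rewrite -[RHS]mul1r -hk; move: (hsize z ^ k) (hsize z ^ - k) (n ^ - k) => P Q S.
  by ring.
- rewrite hpowE// [RHS]mulrC -!mulrA; do 2 congr (_ * _).
  rewrite -!rmorphM/=; congr (_%:C).
  have h0 : hsize z ^+ `|k| != 0 by rewrite expf_neq0.
  have nk0 : n ^+ `|k| != 0 by rewrite expf_neq0.
  rewrite expr_div_n -/n; move: (n ^+ _) (hsize z ^+ _) (weight _ _ _ _) h0 nk0 t0.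
  by move=> P Q S Q0 P0 S0; field; rewrite P0 Q0 S0.
by rewrite mulrC.
Qed.

Lemma chart_inv_point5 i j u a b c : (if j then c else a) != 0 ->
  chart_inv i j (point5 j u a b c) = embed k (affine i u) a b c.
Proof.
have sc (l : R) a' b' c' : l != 0 -> embed k (affine i u) (l * a') (l%:C * b') (l * c') =
    embed k (affine i u) a' b' c'.
  move=> l0; rewrite -[RHS](@embed_scale _ _ 1 l)// ?oner_neq0//; last exact: affine_neq0.
  rewrite nrm21 !exp1rz !mulr1 !mul1r.
  by case: (affine i u).
rewrite /chart_inv /point5 !rowE5 opprB addrC subrK /fib_s /fib_w; case: j => c0.
  by rewrite -[RHS](sc c^-1) ?invr_eq0// mulVf// [_ * a]mulrC [_ * b]mulrC.
rewrite conjcM conjcK conjc_real.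
by rewrite -[RHS](sc a^-1) ?invr_eq0// mulVf// [_ * c]mulrC [_ * b]mulrC.
Qed.

Lemma chart_mapK i j z a b c : hsize z != 0 -> weight k z a c != 0 ->
  entry i z != 0 -> (if j then c else a) != 0 ->
  chart_inv i j (chart_map i j (embed k z a b c)) = embed k z a b c.
Proof.
move=> z0 t0 zi0 c0; rewrite chart_map_embed// chart_inv_point5; last first.
  by case: j c0 => // a0; rewrite mulf_neq0// expfz_neq0// nrm2_eq0.
rewrite -[RHS](@embed_scale _ _ (entry i z)^-1 1)// ?invr_eq0 ?oner_neq0//.
rewrite nrm2V !exprz_inv !mul1r; congr embed.
- by rewrite /affine; case: i zi0 => /= zi0; rewrite mulVf// [_ / _]mulrC.
- by rewrite mulrC.
- by rewrite mulrC.
Qed.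

(** The denominator that limits [chart_inv]. It is positive on the half-space, so its nonvanishing
    locus is an open neighbourhood of the half-space on which [chart_inv] is smooth. *)
Definition chart_weight (i j : bool) (x : 'rV[R]_(1 + 4)) : R :=
  let s := nrm2 (fibre x) - height x in
  weight k (affine i (base x)) (if j then s else 1) (if j then 1 else s).

Lemma chart_invK i j x : chart_weight i j x != 0 ->
  chart_map i j (chart_inv i j x) = x.
Proof.
move=> x0; rewrite /chart_inv chart_map_embed ?affine_neq0 ?entry_affine//.
rewrite entryN_affine invr1 nrm21 !exp1rz !mulr1 /point5 /fib_w /fib_s.
rewrite -[RHS]row5K; case: j x0 => _.
  by rewrite invr1 !mulr1 opprB addrC subrK.
by rewrite invr1 conjcK !mulr1 opprB addrC subrK.
Qed.

Lemma chart_weight_gt0 i j x : halfspace x -> 0 < chart_weight i j x.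
Proof.
rewrite /halfspace /= -[X in X <= 0]/(height x) => x0.
have s0 : 0 <= nrm2 (fibre x) - height x by rewrite subr_ge0 (le_trans x0) ?nrm2_ge0.
rewrite /chart_weight /weight; set N := hsize _.
have N0 : 0 < N by rewrite lt_def affine_neq0 addr_ge0 ?nrm2_ge0.
by case: j; [rewrite ltr_wpDl// mulr_ge0//|rewrite ltr_pwDl// mul1r];
  rewrite ?exprz_ge0 ?exprz_gt0// ltW.
Qed.

(** Passing from the representative [(1, u)] to [(u^-1, 1)] scales z by [u^-1], hence the L(k)
    coordinate by [u ^ (- k)]. So [e] is [- k] for the fibre coordinate [w.1 / w.2] and [k] for its
    inverse; the height is quadratic in the fibre and gets the squared modulus. *)
Definition base_flip (e : int) (x : 'rV[R]_(1 + 4)) : 'rV[R]_(1 + 4) :=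
  row5 (nrm2 (base x) ^ e * height x) (base x)^-1 (base x ^ e * fibre x).

(** The form [(s, v, 1)] is proportional to [(1, v / s, 1 / s)], whose other chart has coordinate
    [conjc v / s] and height [|v|^2 / s^2 - 1 / s = h / s^2]. At height 0 one has [s = |v|^2], and
    the map is [v |-> v^-1]. *)
Definition fibre_flip (x : 'rV[R]_(1 + 4)) : 'rV[R]_(1 + 4) :=
  let s := nrm2 (fibre x) - height x in
  row5 (height x / s ^+ 2) (base x) (conjc (fibre x) * (s^-1)%:C).

Lemma chart_inv_base_flip i j x : base x != 0 ->
  chart_inv (~~ i) j (base_flip (if j then - k else k) x) = chart_inv i j x.
Proof.
move=> z0; rewrite /chart_inv /base_flip !rowE5; set u := base x; set v := fibre x.
set h := height x; set s := nrm2 v - h.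
have n0 : nrm2 u != 0 by rewrite nrm2_eq0.
have au : affine (~~ i) u^-1 = (u^-1 * (affine i u).1, u^-1 * (affine i u).2).
  by case: i; rewrite /affine /= mulr1 mulVf.
rewrite nrm2M nrm2Xz -mulrBr -/s au; case: j.
  rewrite -[RHS](@embed_scale _ _ u^-1 1)// ?invr_eq0 ?oner_neq0 ?affine_neq0//.
  by rewrite nrm2V !exprz_inv !mul1r.
(* In this chart the entry [a] is normalized to 1; the rescaling [nrm2 u ^ k] of the form undoes the
   factor that [u^-1] puts on it. *)
rewrite -[RHS](@embed_scale _ _ u^-1 (nrm2 u ^ k))// ?invr_eq0 ?affine_neq0 ?expfz_neq0//.
rewrite nrm2V !exprz_inv -expfzDr// subrr expr0z !mulr1; congr embed.
rewrite conjcM conjcXz; congr (_ * _).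
rewrite (_ : (nrm2 u ^ k)%:C = u ^ k * (conjc u : C) ^ k); last first.
  by rewrite -expfzMl -nrm2E; case: (k) => n; rewrite ?NegzE -?exprnN ?fmorphV rmorphXn.
by rewrite mulrAC -expfzDr// subrr expr0z mul1r.
Qed.

Lemma chart_inv_fibre_flip i j x : nrm2 (fibre x) - height x != 0 ->
  chart_inv i (~~ j) (fibre_flip x) = chart_inv i j x.
Proof.
rewrite /chart_inv /fibre_flip !rowE5; set u := base x; set v := fibre x.
set h := height x; set s := nrm2 v - h => s0.
have -> : nrm2 (conjc v * (s^-1)%:C : C) - h / s ^+ 2 = s^-1.
  rewrite nrm2M nrm2_conj nrm2_real -exprVn -mulrBl -/s expr2 mulrA mulfV// mul1r.
  by [].
have sc a' b' c' : embed k (affine i u) (s^-1 * a') ((s^-1)%:C * b') (s^-1 * c') =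
    embed k (affine i u) a' b' c'.
  rewrite -[RHS](@embed_scale _ _ 1 s^-1)// ?oner_neq0 ?invr_eq0//; last exact: affine_neq0.
  rewrite nrm21 !exp1rz !mulr1 !mul1r.
  by case: (affine i u).
rewrite -[RHS]sc; case: j; rewrite /negb.
  by rewrite conjcM conjcK conjc_real mulVf// mulr1 mulrC.
by rewrite mulVf// mulr1 mulrC.
Qed.

End Charts.

(** * Smoothness of the charts and their inverses, and openness of the domains of the formulas *)

Section ChartsElementary.
Context {R : realType}.
Local Notation C := (R[i]^o).
Local Open Scope complex_scope.

Lemma row5E (h : R) (u v : C) j : row5 h u v 0 j =
  [:: h; complex.Re u; complex.Im u; complex.Re v; complex.Im v]`_j.
Proof.
rewrite /row5; case: (@split_ordP 1 4 j) => j' ->.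
  by rewrite row_mxEl mxE ord1.
by rewrite row_mxEr mxE.
Qed.

Lemma heightE x : height x = x 0 0 :> R.
Proof. by []. Qed.

Lemma baseE (x : 'rV[R]_(1 + 4)) : base x = Complex (x 0 1) (x 0 2).
Proof.
by rewrite /base /complexify !mxE; congr Complex; congr (x _ _); apply/val_inj.
Qed.

Lemma fibreE (x : 'rV[R]_(1 + 4)) : fibre x = Complex (x 0 3) (x 0 4).
Proof.
by rewrite /fibre /complexify !mxE; congr Complex; congr (x _ _); apply/val_inj.
Qed.

Section Rules.
Context {m : nat} {U : set 'rV[R]_m}.

Lemma elementary_row5 (h : 'rV[R]_m -> R) (u v : 'rV[R]_m -> C) :
  elementary U h -> elementaryC U u -> elementaryC U v ->
  elementary_rV U (fun x => row5 (h x) (u x) (v x)).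
Proof.
move=> Uh [Ru Iu] [Rv Iv] j.
apply: (@elementary_ext _ _ _ (fun x => [:: h x; complex.Re (u x); complex.Im (u x);
  complex.Re (v x); complex.Im (v x)]`_j)); first by move=> x _; rewrite row5E.
by case: j => -[|[|[|[|[|//]]]]].
Qed.

Lemma elementary_embed k (z1 z2 b : 'rV[R]_m -> C) (a c : 'rV[R]_m -> R) :
  (forall x, U x -> hsize (z1 x, z2 x) != 0) ->
  (forall x, U x -> weight k (z1 x, z2 x) (a x) (c x) != 0) ->
  elementaryC U z1 -> elementaryC U z2 -> elementary U a -> elementaryC U b ->
  elementary U c -> elementary_rV U (fun x => embed k (z1 x, z2 x) (a x) (b x) (c x)).
Proof.
move=> z0 t0 U1 U2 Ua Ub Uc.
have Uz : elementary U (fun x => hsize (z1 x, z2 x)).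
  exact: elementaryD (elementary_nrm2 U1) (elementary_nrm2 U2).
have Uk := elementaryXz (- k) z0 Uz.
have Ut : elementary U (fun x => weight k (z1 x, z2 x) (a x) (c x)).
  exact: elementaryD (elementaryM Ua Uk) Uc.
have Uden : elementary U (fun x => (hsize (z1 x, z2 x) ^+ `|k|%N *
    weight k (z1 x, z2 x) (a x) (c x))^-1).
  apply: elementaryV; last exact: elementaryM (elementaryX _ Uz) Ut.
  by move=> x Ux; rewrite mulf_neq0 ?expf_neq0 ?z0 ?t0.
have [R12 I12] := elementaryCM U2 (elementaryC_conj U1).
have [R1 I1] := elementaryCM Ub (elementary_hpow k U1).
have [R2 I2] := elementaryCM Ub (elementary_hpow k U2).
move=> j; have Vz := elementaryV z0 Uz; have Vt := elementaryV t0 Ut.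
case: j => -[|[|[|[|[|[|[|[|[|[|//]]]]]]]]]] jlt;
  under eq_fun do rewrite mxE /=; apply: elementaryM => //.
- exact: elementary_nrm2 U1.
- exact: elementary_nrm2 U2.
- exact: elementaryM Ua Uk.
Qed.

End Rules.

Lemma elementary_height (U : set 'rV[R]_(1 + 4)) : elementary U (@height R).
Proof. exact: elementary_coord. Qed.

Lemma elementary_base (U : set 'rV[R]_(1 + 4)) : elementaryC U (@base R).
Proof.
apply: (@elementaryC_ext _ _ _ (fun x => Complex (x 0 1) (x 0 2))).
  by move=> x _; rewrite baseE.
by split; exact: elementary_coord.
Qed.

Lemma elementary_fibre (U : set 'rV[R]_(1 + 4)) : elementaryC U (@fibre R).
Proof.
apply: (@elementaryC_ext _ _ _ (fun x => Complex (x 0 3) (x 0 4))).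
  by move=> x _; rewrite fibreE.
by split; exact: elementary_coord.
Qed.

Lemma elementary_chart_map k i j :
  elementary_rV [set p | chart_open i j p] (@chart_map R k i j).
Proof.
set U := [set p | _]; have Un : elementary U (@pnorm R i) by exact: elementary_coord.
have n0 p : U p -> pnorm i p != 0 by case.
have Ub : elementaryC U (@pbase R i).
  by split; case: i @U Un n0 => U Un n0; rewrite /pbase /=;
    first [exact: elementary_coord|apply: elementaryN; exact: elementary_coord].
have Uf : elementaryC U (@pfib R i).
  by split; case: i @U Un n0 Ub => U Un n0 Ub; rewrite /pfib /=; exact: elementary_coord.
have UA : elementary U (fun p => pdiag false p * pnorm i p ^ (- k)).
  by apply: elementaryM; [exact: elementary_coord|exact: elementaryXz].
have UB : elementaryC U (fun p => pfib i p * (pnorm i p ^- `|k|%N)%:C).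
  apply: elementaryCM => //; apply: elementaryC_real; apply: elementaryV.
    by move=> p /n0; exact: expf_neq0.
  exact: elementaryX.
have UC : elementary U (pdiag true) by exact: elementary_coord.
have Uw : elementaryC U (fun p => fib_w j (pdiag false p * pnorm i p ^ (- k))
  (pfib i p * (pnorm i p ^- `|k|%N)%:C) (pdiag true p)).
  rewrite /fib_w; case: j @U Un n0 Ub Uf UA UB UC => U Un n0 Ub Uf UA UB UC.
    apply: elementaryCM => //; apply: elementaryC_real; apply: elementaryV => //.
    by move=> p [].
  apply: elementaryCM; first exact: elementaryC_conj.
  apply: elementaryC_real; apply: elementaryV => // p [p0 d0].
  by rewrite mulf_neq0 ?expfz_neq0.
apply: elementary_row5 => //; last first.
  by apply: elementaryCM => //; apply: elementaryC_real; exact: elementaryV.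
apply: elementaryB; first exact: elementary_nrm2.
rewrite /fib_s; case: j @U Un n0 Ub Uf UA UB UC Uw => U Un n0 Ub Uf UA UB UC Uw.
  by apply: elementaryM => //; apply: elementaryV => // p [].
apply: elementaryM => //; apply: elementaryV => // p [p0 d0].
by rewrite mulf_neq0 ?expfz_neq0.
Qed.

Lemma elementary_chart_inv k i j :
  elementary_rV [set x | chart_weight k i j x != 0] (@chart_inv R k i j).
Proof.
set U := [set x | _].
pose s (x : 'rV[R]_(1 + 4)) := nrm2 (fibre x) - height x.
have Us : elementary U s.
  by apply: elementaryB; [apply: elementary_nrm2; exact: elementary_fibre|
                          exact: elementary_height].
have Uf := elementary_fibre U; have Ub := elementary_base U.
have U1 := elementaryC_cst (U := U) 1; have Ur := elementary_cst U 1.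
pose a x := if j then s x else 1; pose c x := if j then 1 else s x.
pose b (x : 'rV[R]_(1 + 4)) : C := if j then fibre x else conjc (fibre x).
pose z1 (x : 'rV[R]_(1 + 4)) : C := if i then base x else 1.
pose z2 (x : 'rV[R]_(1 + 4)) : C := if i then 1 else base x.
have zE x : (z1 x, z2 x) = affine i (base x) by rewrite /z1 /z2; case: (i).
apply: (@elementary_rV_ext _ _ _ _ (fun x => embed k (z1 x, z2 x) (a x) (b x) (c x))).
  by move=> x _; rewrite /chart_inv zE.
apply: elementary_embed.
- by move=> x _; rewrite zE affine_neq0.
- by move=> x; rewrite zE.
- by rewrite /z1; case: (i).
- by rewrite /z2; case: (i).
- by rewrite /a; case: (j).
- by rewrite /b; case: (j) => //; exact: elementaryC_conj.
- by rewrite /c; case: (j).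
Qed.

Lemma elementary_open m p (U : set 'rV[R]_m) (V : set 'rV[R]_p) g :
  open U -> open V -> elementary_rV U g -> open (U `&` g @^-1` V).
Proof.
move=> oU oV Ug; rewrite openE => x [Ux Vx].
have cg := elementary_continuous oU Ug Ux.
by apply: filterI; [exact: open_nbhs_nbhs|apply: cg; exact: open_nbhs_nbhs].
Qed.

Lemma elementary_neq0_open m (f : 'rV[R]_m -> R) :
  elementary setT f -> open [set x | f x != 0].
Proof.
move=> Tf; apply: (open_comp _ (@open_neq R 0)) => x _.
by apply: differentiable_continuous; exact: (elementary_diff openT Tf).1.
Qed.

Lemma chart_open_open i j : open [set p : 'rV[R]_10 | chart_open i j p].
Proof.
apply: openI; apply: elementary_neq0_open; exact: elementary_coord.
Qed.

Lemma chart_weight_open k i j : open [set x : 'rV[R]_(1 + 4) | chart_weight k i j x != 0].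
Proof.
apply: elementary_neq0_open; rewrite /chart_weight /weight.
have Ub := elementary_base setT.
have Us : elementary setT (fun x : 'rV[R]_(1 + 4) => nrm2 (fibre x) - height x).
  by apply: elementaryB; [apply: elementary_nrm2; exact: elementary_fibre|
                          exact: elementary_height].
have U1 := elementary_cst [set: 'rV[R]_(1 + 4)] 1.
apply: elementaryD; last by case: j.
apply: elementaryM; first by case: j.
apply: elementaryXz; first by move=> x _; exact: affine_neq0.
under eq_fun do rewrite hsize_affine.
by apply: elementaryD => //; exact: elementary_nrm2.
Qed.

End ChartsElementary.

(** * Orientation of the transition maps *)

(* Without this, unification compares differentials by unfolding them. *)
Local Opaque jacobian.

Section Flips.
Context {R : realType}.
Local Notation C := (R[i]^o).
Local Open Scope complex_scope.
Implicit Types x : 'rV[R]_(1 + 4).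

Lemma height_shift t (i : 'I_(1 + 4)) x :
  height (t *: delta_mx 0 i + x) = t *+ (i == 0 :> nat) + height x.
Proof. by rewrite !heightE !mxE eqxx /= [0 == i]eq_sym mulr_natr. Qed.

Lemma base_shift t (i : 'I_(1 + 4)) x :
  base (t *: delta_mx 0 i + x) =
  Complex (t *+ (i == 1%N :> nat)) (t *+ (i == 2%N :> nat)) + base x.
Proof.
by rewrite !baseE !mxE eqxx /= [1 == i]eq_sym [2 == i]eq_sym !mulr_natr.
Qed.

Lemma fibre_shift t (i : 'I_(1 + 4)) x :
  fibre (t *: delta_mx 0 i + x) =
  Complex (t *+ (i == 3%N :> nat)) (t *+ (i == 4%N :> nat)) + fibre x.
Proof.
by rewrite !fibreE !mxE eqxx /= [3 == i]eq_sym [4 == i]eq_sym !mulr_natr.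
Qed.

Lemma jacobian_affine m p (g : 'rV[R]_m -> 'rV[R]_p) (x : 'rV[R]_m) i j c :
  differentiable g x ->
  (forall t, g (t *: delta_mx 0 i + x) 0 j = g x 0 j + t * c) -> 'J g x i j = c.
Proof. by move=> dg gc; rewrite (jacobianE i j dg); exact: derive_affine. Qed.

(** An involution exchanging the height with [s], the quotient of the diagonal entries of the form.
    In terms of [s] the fibre flip is the plain [inversion]. *)
Definition shear x : 'rV[R]_(1 + 4) :=
  row5 (nrm2 (fibre x) - height x) (base x) (fibre x).

Lemma elementary_shear : elementary_rV [set: 'rV[R]_(1 + 4)] shear.
Proof.
apply: elementary_row5; [|exact: elementary_base|exact: elementary_fibre].
by apply: elementaryB; [apply: elementary_nrm2; exact: elementary_fibre|
                        exact: elementary_height].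
Qed.

Lemma differentiable_shear x : differentiable shear x.
Proof. by apply: (elementary_differentiable openT elementary_shear). Qed.

Lemma det_shear x : \det ('J shear x) = -1.
Proof.
have dg := differentiable_shear x.
pose J i j c := @jacobian_affine (1 + 4) (1 + 4) shear x i j c dg.
rewrite det_mx5_lower; first last.
- move=> i j i3 j12; apply: J => t; rewrite !row5E base_shift.
  by case: i i3 => -[|[|[|[|[|//]]]]] //= ? _; case: j j12 => -[|[|[|//]]] //= ? _;
    rewrite ?mulr0n mulr0 addr0; case: (base x) => a b /=; rewrite add0r.
- move=> i j i0 j0; apply: J => t; rewrite !row5E base_shift fibre_shift i0.
  by case: j j0 => -[|[|[|[|[|//]]]]] //= ? _; rewrite !mulr0n mulr0 addr0;
    [case: (base x)|case: (base x)|case: (fibre x)|case: (fibre x)] => a b /=;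
    rewrite add0r.
have J00 : 'J shear x 0 0 = -1.
  apply: J => t; rewrite !row5E fibre_shift height_shift /= mulr0n.
  by rewrite (_ : Complex 0 0 = 0)// add0r; ring.
have J11 : 'J shear x 1 1 = 1.
  by apply: J => t; rewrite !row5E base_shift /= mulr1 addrC; case: (base x).
have J12 : 'J shear x 1 2 = 0.
  by apply: J => t; rewrite !row5E base_shift /= mulr0 addrC; case: (base x).
have J22 : 'J shear x 2 2 = 1.
  by apply: J => t; rewrite !row5E base_shift /= mulr1 addrC; case: (base x).
have J33 : 'J shear x 3 3 = 1.
  by apply: J => t; rewrite !row5E fibre_shift /= mulr1 addrC; case: (fibre x).
have J34 : 'J shear x 3 4 = 0.
  by apply: J => t; rewrite !row5E fibre_shift /= mulr0 addrC; case: (fibre x).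
have J44 : 'J shear x 4 4 = 1.
  by apply: J => t; rewrite !row5E fibre_shift /= mulr1 addrC; case: (fibre x).
by rewrite J00 J11 J12 J22 J33 J34 J44; ring.
Qed.

Definition inversion x : 'rV[R]_(1 + 4) :=
  row5 (height x)^-1 (base x) (conjc (fibre x) * ((height x)^-1)%:C).

Lemma elementary_inversion :
  elementary_rV [set x : 'rV[R]_(1 + 4) | height x != 0] inversion.
Proof.
have hV : elementary [set x : 'rV[R]_(1 + 4) | height x != 0] (fun x => (height x)^-1).
  by apply: elementaryV => //; exact: elementary_height.
apply: elementary_row5 => //; first exact: elementary_base.
apply: elementaryCM; last exact: elementaryC_real.
by apply: elementaryC_conj; exact: elementary_fibre.
Qed.

Lemma differentiable_inversion x : height x != 0 -> differentiable inversion x.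
Proof.
move=> x0; apply: (elementary_differentiable _ elementary_inversion) => //.
exact: elementary_neq0_open (elementary_height setT).
Qed.

Lemma derive_quot (V : normedModType R) (f n : V -> R) (x v : V) :
  differentiable f x -> differentiable n x -> n x != 0 ->
  'D_v (fun y => f y / n y) x = ('D_v f x * n x - f x * 'D_v n x) / n x ^+ 2.
Proof.
move=> df dn n0; have df' := diff_derivable (v := v) df.
have dn' := diff_derivable (v := v) dn.
have dV := derivableV n0 dn'.
rewrite -[LHS]/('D_v (f * (fun y => (n y)^-1)) x) (deriveM df' dV) (deriveV n0 dn').
rewrite -![_ *: _]/(_ * _).
by field; rewrite n0.
Qed.

(** Inverting a real number and conjugating a complex one both reverse orientation; the signs cancel
    and the determinant is [height x ^- 4]. *)
Lemma det_inversion x : height x != 0 -> 0 < \det ('J inversion x).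
Proof.
move=> x0; have dg := differentiable_inversion x0.
pose J i j c := @jacobian_affine (1 + 4) (1 + 4) inversion x i j c dg.
rewrite det_mx5_upper; first last.
- move=> i j i3 j12; apply: J => t; rewrite !row5E base_shift.
  by case: i i3 => -[|[|[|[|[|//]]]]] //= ? _; case: j j12 => -[|[|[|//]]] //= ? _;
    rewrite ?mulr0n mulr0 addr0; case: (base x) => a b /=; rewrite add0r.
- move=> i j i0 j0; apply: J => t; rewrite !row5E height_shift j0 /= mulr0 addr0.
  by case: i i0 => -[|[|[|[|[|//]]]]] //= ? _; rewrite mulr0n add0r.
have J00 : 'J inversion x 0 0 = - (height x ^+ 2)^-1.
  rewrite (jacobianE 0 0 dg).
  rewrite (_ : (fun y => _) = (fun y => 1 / height y)); last first.
    by apply/funext => y; rewrite row5E /= mul1r.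
  rewrite derive_quot//; first last.
    exact: differentiable_coord.
  rewrite derive_cst mul0r sub0r mul1r (@derive_affine _ _ _ x _ 1) ?mulN1r//.
  by move=> t; rewrite height_shift mulr1n mulr1 addrC.
have J11 : 'J inversion x 1 1 = 1.
  by apply: J => t; rewrite !row5E base_shift /= mulr1 addrC; case: (base x).
have J12 : 'J inversion x 1 2 = 0.
  by apply: J => t; rewrite !row5E base_shift /= mulr0 addrC; case: (base x).
have J22 : 'J inversion x 2 2 = 1.
  by apply: J => t; rewrite !row5E base_shift /= mulr1 addrC; case: (base x).
have J33 : 'J inversion x 3 3 = (height x)^-1.
  apply: J => t; rewrite !row5E fibre_shift height_shift /= mulr1n !mulr0n !add0r.
  by move: (fibre x) (height x)^-1 => [a b] h /=; ring.
have J34 : 'J inversion x 3 4 = 0.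
  apply: J => t; rewrite !row5E fibre_shift height_shift /= mulr1n !mulr0n !add0r.
  by move: (fibre x) (height x)^-1 => [a b] h /=; ring.
have J44 : 'J inversion x 4 4 = - (height x)^-1.
  apply: J => t; rewrite !row5E fibre_shift height_shift /= mulr1n !mulr0n !add0r.
  by move: (fibre x) (height x)^-1 => [a b] h /=; ring.
rewrite J00 J11 J12 J22 J33 J34 J44 !mul0r !subr0 !mulr1 mulrN mulrNN.
by rewrite -expr2 exprVn -expr2 exprn_even_gt0//= invr_eq0 expf_neq0.
Qed.

Lemma fibre_flipE : fibre_flip =1 shear \o (inversion \o shear).
Proof.
move=> x; rewrite /fibre_flip /= /shear /inversion !rowE5; set s := nrm2 _ - _.
(* At [s = 0] both heights are 0 by the convention for inverses, so the identity holds everywhere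
   and can be used under differentiation. *)
congr row5; have [->|s0] := eqVneq s 0; first by rewrite expr0n !invr0 !mulr0 nrm20 subrr.
rewrite nrm2M nrm2_conj nrm2_real /s; set n := nrm2 _ in s s0 *.
by field.
Qed.

(** The two shears contribute [-1] each, so the sign is that of the inversion. *)
Lemma positive_fibre_flip x : nrm2 (fibre x) - height x != 0 -> positive_at fibre_flip x.
Proof.
move=> x0; have hs : height (shear x) != 0 by rewrite height_row5.
have d1 := differentiable_shear x; have d2 := differentiable_inversion hs.
have d3 := differentiable_shear (inversion (shear x)).
rewrite (funext fibre_flipE); have d12 := differentiable_comp d1 d2.
split; first exact: differentiable_comp d12 d3.
have J3 := jacobian_comp d12 d3; have J2 := jacobian_comp d1 d2.
have detM (A B D : 'M[R]_5) : \det A = -1 -> 0 < \det B -> \det D = -1 ->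
    0 < \det (A *m B *m D).
  by move=> A1 B0 D1; rewrite !det_mulmx A1 D1 mulN1r mulrN1 opprK.
have := detM _ _ _ (det_shear x) (det_inversion hs) (det_shear (inversion (shear x))).
by rewrite -J2 -J3.
Qed.

Lemma elementary_base_flip e :
  elementary_rV [set x : 'rV[R]_(1 + 4) | base x != 0] (base_flip e).
Proof.
set U := [set x | _]; have Ub := elementary_base U; have Uf := elementary_fibre U.
have b0 x : U x -> base x != 0 by [].
apply: elementary_row5; last by apply: elementaryCM => //; exact: elementaryCXz.
  apply: elementaryM; last exact: elementary_height.
  by apply: elementaryXz; [move=> x; rewrite nrm2_eq0|exact: elementary_nrm2].
exact: elementaryCV.
Qed.

Lemma base_neq0_open : open [set x : 'rV[R]_(1 + 4) | base x != 0].
Proof.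
under eq_set do rewrite -nrm2_eq0.
by apply: elementary_neq0_open; apply: elementary_nrm2; exact: elementary_base.
Qed.

(** The diagonal blocks are a positive factor for the height and two holomorphic derivatives, of
    [u |-> u^-1] and of [v |-> u^e v], whose real determinants are squared moduli. The base block is
    the one that is not affine along coordinate lines and takes the quotient rule. *)
Lemma positive_base_flip e x : base x != 0 -> positive_at (base_flip e) x.
Proof.
move=> x0; have dg : differentiable (base_flip e) x.
  exact: elementary_differentiable base_neq0_open (elementary_base_flip e) x0.
split=> //.
pose J i j c := @jacobian_affine (1 + 4) (1 + 4) (base_flip e) x i j c dg.
rewrite det_mx5_lower; first last.
- move=> i j i3 j12; apply: J => t; rewrite !row5E base_shift.
  have -> : Complex (t *+ (i == 1%N :> nat)) (t *+ (i == 2%N :> nat)) = 0 :> C.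
    by case: i i3 => -[|[|[|[|[|//]]]]].
  by rewrite add0r; case: j j12 => -[|[|[|//]]] //= ? _; rewrite mulr0 addr0.
- move=> i j i0 j0; apply: J => t; rewrite !row5E base_shift fibre_shift i0 /=.
  rewrite !mulr0n (_ : Complex 0 0 = 0 :> C)// !add0r mulr0 addr0.
  by case: j j0 => -[|[|[|[|[|//]]]]].
have J00 : 'J (base_flip e) x 0 0 = nrm2 (base x) ^ e.
  apply: J => t; rewrite !row5E base_shift height_shift /= !mulr0n mulr1n.
  by rewrite (_ : Complex 0 0 = 0 :> C)// add0r mulrDr addrC [t * _]mulrC.
set l : C := base x ^ e; have l0 : l != 0 by exact: expfz_neq0.
have C00 : Complex 0 0 = 0 :> C by [].
have J33 : 'J (base_flip e) x 3 3 = complex.Re l.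
  apply: J => t; rewrite !row5E base_shift fibre_shift /= !mulr0n C00 add0r -/l.
  by move: (l) (fibre x) => [p q] [a b] /=; ring.
have J34 : 'J (base_flip e) x 3 4 = complex.Im l.
  apply: J => t; rewrite !row5E base_shift fibre_shift /= !mulr0n C00 add0r -/l.
  by move: (l) (fibre x) => [p q] [a b] /=; ring.
have J43 : 'J (base_flip e) x 4 3 = - complex.Im l.
  apply: J => t; rewrite !row5E base_shift fibre_shift /= !mulr0n C00 add0r -/l.
  by move: (l) (fibre x) => [p q] [a b] /=; ring.
have J44 : 'J (base_flip e) x 4 4 = complex.Re l.
  apply: J => t; rewrite !row5E base_shift fibre_shift /= !mulr0n C00 add0r -/l.
  by move: (l) (fibre x) => [p q] [a b] /=; ring.
pose a := complex.Re (base x); pose b := complex.Im (base x).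
have [Re_el Im_el] := elementary_base [set: 'rV[R]_(1 + 4)].
have dRe : differentiable (fun y : 'rV[R]_(1 + 4) => complex.Re (base y)) x.
  exact: (elementary_diff openT Re_el).1.
have dIm : differentiable (fun y : 'rV[R]_(1 + 4) => complex.Im (base y)) x.
  exact: (elementary_diff openT Im_el).1.
have dnIm : differentiable (fun y : 'rV[R]_(1 + 4) => - complex.Im (base y)) x.
  exact: differentiableN.
have DRe (i : 'I_(1 + 4)) : 'D_(delta_mx 0 i) (fun y : 'rV[R]_(1 + 4) =>
    complex.Re (base y)) x = (i == 1%N :> nat)%:R.
  apply: derive_affine => t; rewrite base_shift; case: (base x) => p q /=.
  by rewrite addrC mulr_natr.
have DIm (i : 'I_(1 + 4)) : 'D_(delta_mx 0 i) (fun y : 'rV[R]_(1 + 4) =>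
    complex.Im (base y)) x = (i == 2%N :> nat)%:R.
  apply: derive_affine => t; rewrite base_shift; case: (base x) => p q /=.
  by rewrite addrC mulr_natr.
have DnIm (i : 'I_(1 + 4)) : 'D_(delta_mx 0 i) (fun y : 'rV[R]_(1 + 4) =>
    - complex.Im (base y)) x = - (i == 2%N :> nat)%:R.
  by rewrite -DIm -deriveN//; exact: diff_derivable.
have n0 : nrm2 (base x) != 0 by rewrite nrm2_eq0.
have dn : differentiable (fun y : 'rV[R]_(1 + 4) => nrm2 (base y)) x.
  exact: (elementary_diff openT (elementary_nrm2 (elementary_base setT))).1.
have Dn (i : 'I_(1 + 4)) : 'D_(delta_mx 0 i) (fun y : 'rV[R]_(1 + 4) =>
    nrm2 (base y)) x = 2 * (a * (i == 1%N :> nat)%:R + b * (i == 2%N :> nat)%:R).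
  have dRe' := diff_derivable (v := delta_mx 0 i) dRe.
  have dIm' := diff_derivable (v := delta_mx 0 i) dIm.
  rewrite -[LHS]/('D_(delta_mx 0 i) ((fun y : 'rV[R]_(1 + 4) => complex.Re (base y)) ^+ 2
    + (fun y : 'rV[R]_(1 + 4) => complex.Im (base y)) ^+ 2) x).
  rewrite (deriveD (derivableX (n := 2) dRe') (derivableX (n := 2) dIm')).
  rewrite (deriveX _ dRe') (deriveX _ dIm') DRe DIm.
  by rewrite -![_ *: _]/(_ * _) !expr1 -!mulrA mulrDr.
have J1 (i : 'I_5) := jacobianE i 1 dg; have J2 (i : 'I_5) := jacobianE i 2 dg.
have E1 : (fun y : 'rV[R]_(1 + 4) => base_flip e y 0 1) =
    (fun y => complex.Re (base y) / nrm2 (base y)).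
  by apply/funext => y; rewrite row5E -[LHS]/(complex.Re (base y)^-1) Re_inv.
have E2 : (fun y : 'rV[R]_(1 + 4) => base_flip e y 0 2) =
    (fun y => - complex.Im (base y) / nrm2 (base y)).
  by apply/funext => y; rewrite row5E -[LHS]/(complex.Im (base y)^-1) Im_inv.
rewrite E1 in J1; rewrite E2 in J2.
rewrite J00 J33 J34 J43 J44 !J1 !J2 !derive_quot// !DRe !DnIm !Dn -/a -/b /=.
have nE : nrm2 (base x) = a ^+ 2 + b ^+ 2 by [].
apply: mulr_gt0; first apply: mulr_gt0.
- by rewrite exprz_gt0// nrm2_gt0.
- rewrite (_ : _ - _ = (nrm2 (base x) ^+ 2)^-1).
    by rewrite invr_gt0 exprn_even_gt0.
  rewrite nE in n0 *; move: (a) (b) n0 => p q n0.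
  by field; rewrite n0.
- by rewrite mulrN opprK -!expr2 -[X in 0 < X]/(nrm2 l) nrm2_gt0.
Qed.

End Flips.

(** * Positivity of the Jacobian induced on the boundary hyperplane *)

Section BoundaryJacobian.
Context {R : realType}.

Lemma positive_at_id m (x : 'rV[R]_m) : positive_at (fun y => y) x.
Proof.
have did : differentiable (fun y : 'rV[R]_m => y) x.
  exact: (elementary_differentiable openT (fun j => elementary_coord setT j) I).
split=> //; rewrite (_ : 'J _ x = 1%:M) ?det1 ?ltr01//.
apply/matrixP => i j; rewrite (jacobianE i j did) [RHS]mxE.
by apply: derive_affine => h; rewrite !mxE eqxx [j == i]eq_sym addrC.
Qed.

(** A directional derivative sees only the restriction to a line; this compares derivatives of maps
    on R^4 and on R^5. *)
Lemma derive_line (V V' W : normedModType R) (f : V -> W) (f' : V' -> W) a v a' v' :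
  (forall h : R, f (h *: v + a) = f' (h *: v' + a')) -> 'D_v f a = 'D_v' f' a'.
Proof.
move=> ff'; have fa : f a = f' a' by have := ff' 0; rewrite !scale0r !add0r.
rewrite /derive (_ : (fun h => h^-1 *: ((f \o shift a) (h *: v) - f a)) =
  (fun h => h^-1 *: ((f' \o shift a') (h *: v') - f' a')))//.
by apply/funext => h /=; rewrite ff' fa.
Qed.

(** For [h < 0] the difference quotient divides a nonpositive number by a negative one, and the
    derivative is the limit of these quotients. *)
Lemma derive_le0_ge0 (V : normedModType R) (f : V -> R) a v :
  derivable f a v -> f a = 0 -> (\forall h \near (0 : R), h <= 0 -> f (h *: v + a) <= 0) ->
  0 <= 'D_v f a.
Proof.
move=> df fa fle; rewrite ['D_v f a]cvg_at_leftE; last exact: df.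
apply: limr_ge.
  rewrite -(cvg_at_leftE (fun h => h^-1 *: ((f \o shift a) _ - f a))) //.
  apply: cvg_trans df; apply: cvg_app.
  by move=> A [e egt0 Ae]; exists e => // x xe xgt0; apply: Ae => //; exact/ltr0_neq0.
near=> h; have h0 : h < 0 by near: h; exact: nbhs_left_lt.
rewrite /= fa subr0; apply: mulr_le0; first by rewrite invr_le0 ltW.
have : h <= 0 -> f (h *: v + a) <= 0 by near: h; exact: cvg_within fle.
by apply; exact: ltW.
Unshelve. all: by end_near. Qed.

(* If [g] preserves the boundary hyperplane, its Jacobian matrix there is block
   triangular, and the normal entry is nonnegative as [g] preserves the side. *)
Lemma positive_at_boundary (g : 'rV[R]_(1 + 4) -> 'rV[R]_(1 + 4)) (y : 'rV[R]_4) :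
  positive_at g (row_mx 0 y) ->
  (\near y, height (g (row_mx 0 y)) = 0) ->
  (\forall h \near (0 : R), h <= 0 -> height (g (row_mx (const_mx h) y)) <= 0) ->
  positive_at (fun y => rsubmx (g (row_mx 0 y))) y.
Proof.
move=> [dg Jg] g0 gle; set g4 := fun y => _.
have shiftE h (i : 'I_4) : row_mx 0 (h *: delta_mx 0 i + y) =
    h *: delta_mx 0 (rshift 1 i) + row_mx 0 y :> 'rV[R]_(1 + 4).
  apply/rowP => j; case: (@split_ordP 1 4 j) => j' ->.
    by rewrite row_mxEl [RHS]mxE row_mxEl !mxE eq_shift andbF mulr0 addr0.
  by rewrite row_mxEr [RHS]mxE row_mxEr !mxE eq_shift.
have shift0E h : row_mx (const_mx h) y =
    h *: delta_mx 0 (lshift 4 0) + row_mx 0 y :> 'rV[R]_(1 + 4).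
  apply/rowP => j; case: (@split_ordP 1 4 j) => j' ->.
    by rewrite row_mxEl [RHS]mxE row_mxEl !mxE ord1 !eqxx mulr1 addr0.
  by rewrite row_mxEr [RHS]mxE row_mxEr !mxE eq_shift andbF mulr0 add0r.
have dinc : differentiable (fun y : 'rV[R]_4 => row_mx 0 y : 'rV[R]_(1 + 4)) y.
  apply: differentiable_rV => j; case: (@split_ordP 1 4 j) => j' ->.
    by under eq_fun do rewrite row_mxEl mxE; exact: differentiable_cst.
  by under eq_fun do rewrite row_mxEr; exact: differentiable_coord.
have dg0 : differentiable (fun y : 'rV[R]_4 => g (row_mx 0 y)) y.
  exact: differentiable_comp dinc dg.
have dg4 : differentiable g4 y.
  exact: differentiable_comp dg0 (differentiable_rsubmx _).
split=> //.
have JE i j : 'J g4 y i j = 'J g (row_mx 0 y) (rshift 1 i) (rshift 1 j).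
  rewrite (jacobianE i j dg4) (jacobianE _ _ dg).
  by apply: derive_line => h; rewrite /g4 mxE shiftE.
have J0 i : 'J g (row_mx 0 y) (rshift 1 i) (lshift 4 0) = 0.
  rewrite (jacobianE _ _ dg) -[RHS](derive_cst (0 : R) y (delta_mx 0 i)).
  rewrite -(near_eq_derive (delta_mx 0 i) g0).
  apply: derive_line => h; rewrite shiftE /height.
  by congr (g _ _ _); apply/val_inj.
have J00 : 0 <= 'J g (row_mx 0 y) (lshift 4 0) (lshift 4 0).
  rewrite (jacobianE _ _ dg).
  have hE x : g x 0 (lshift 4 0) = height (g x).
    by rewrite /height; congr (g _ _ _); apply/val_inj.
  apply: derive_le0_ge0.
  - by apply: diff_derivable; exact: differentiable_comp dg (differentiable_coord _ _ _).
  - by rewrite hE; exact: nbhs_singleton g0.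
  - by apply: filterS gle => h; rewrite hE -shift0E.
have detE : \det ('J g (row_mx 0 y)) =
    'J g (row_mx 0 y) (lshift 4 0) (lshift 4 0) * \det ('J g4 y).
  have E5 := congr1 (@determinant R (1 + 4)) (@submxK R 1 4 1 4 ('J g (row_mx 0 y))).
  rewrite -[LHS]/(@determinant R (1 + 4) _) -{}E5.
  have -> : @dlsubmx R 1 4 1 4 ('J g (row_mx 0 y)) = 0.
    by apply/matrixP => i j; rewrite 2!mxE [RHS]mxE ord1; exact: J0.
  rewrite det_ublock det_mx11 2!mxE; congr (_ * \det _).
  by apply/matrixP => i j; rewrite JE 2!mxE.
(* Positivity of the full determinant excludes a zero normal entry, so that entry is positive and
   can be divided out. *)
by move: Jg; rewrite detE; rewrite le_eqVlt in J00; case/orP: J00 => [/eqP<-|J00];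
  rewrite ?mul0r ?ltxx// pmulr_rgt0.
Qed.

End BoundaryJacobian.

(** * Transition maps of the disc bundle as compositions of flips *)

Section Transitions.
Context {R : realType}.
Local Notation C := (R[i]^o).
Context (k : int).

(** The base is flipped first, while the fibre coordinate is still that of [j]; this decides the
    sign of the exponent. *)
Definition flip (i j i' j' : bool) (x : 'rV[R]_(1 + 4)) : 'rV[R]_(1 + 4) :=
  let y := if i == i' then x else base_flip (if j then - k else k) x in
  if j == j' then y else fibre_flip y.

Definition transition (i j i' j' : bool) : 'rV[R]_(1 + 4) -> 'rV[R]_(1 + 4) :=
  chart_map k i' j' \o chart_inv k i j.

(** An open set reaching beyond the half-space, on which the transition formula is elementary. *)
Definition transition_dom (i j i' j' : bool) : set 'rV[R]_(1 + 4) :=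
  [set x | chart_weight k i j x != 0] `&` chart_inv k i j @^-1` [set p | chart_open i' j' p].

Lemma transition_dom_open i j i' j' : open (transition_dom i j i' j').
Proof.
apply: elementary_open; [exact: chart_weight_open|exact: chart_open_open|].
exact: elementary_chart_inv.
Qed.

Lemma elementary_transition i j i' j' :
  elementary_rV (transition_dom i j i' j') (transition i j i' j').
Proof.
apply: elementary_rV_comp (elementary_chart_map k i' j').
  by move=> x [].
by move=> n; apply: elementary_sub (elementary_chart_inv k i j n) => x [].
Qed.

Lemma nrm2_base_flip e (x : 'rV[R]_(1 + 4)) :
  nrm2 (fibre (base_flip e x)) - height (base_flip e x) =
  nrm2 (base x) ^ e * (nrm2 (fibre x) - height x).
Proof. by rewrite /base_flip !rowE5 nrm2M nrm2Xz mulrBr. Qed.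

Lemma transition_dom_base i j i' j' x : transition_dom i j i' j' x ->
  i != i' -> base x != 0.
Proof.
move=> [/= wx [+ _]] ii'; rewrite /chart_inv pnorm_embed mulf_eq0 negb_or.
move=> /andP[+ _]; rewrite nrm2_eq0; apply: contra => /eqP x0.
by case: i i' ii' {wx} => -[] //= _; rewrite x0.
Qed.

Lemma transition_dom_fibre i j i' j' x : transition_dom i j i' j' x ->
  j != j' -> nrm2 (fibre x) - height x != 0.
Proof.
move=> [/= wx [_ +]] jj'; rewrite /chart_inv pdiag_embed mulf_eq0 negb_or.
move=> /andP[+ _]; apply: contra => /eqP ->.
by case: j j' jj' {wx} => -[] //= _; rewrite mul0r.
Qed.

Lemma chart_inv_flip i j i' j' x : transition_dom i j i' j' x ->
  chart_inv k i' j' (flip i j i' j' x) = chart_inv k i j x.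
Proof.
move=> Ux; have b0 := transition_dom_base Ux; have f0 := transition_dom_fibre Ux.
rewrite /flip; case: (eqVneq i i') b0 => [<- _|ii' b0].
  case: (eqVneq j j') f0 => [<- _//|jj' f0].
  have -> : j' = ~~ j by case: j j' jj' {f0 Ux} => -[].
  by rewrite chart_inv_fibre_flip// f0.
have -> : i' = ~~ i by case: i i' ii' {f0 b0 Ux} => -[].
case: (eqVneq j j') f0 => [<- _//|jj' f0]; first by rewrite chart_inv_base_flip// b0.
have -> : j' = ~~ j by case: j j' jj' {f0 b0 Ux} => -[].
rewrite chart_inv_fibre_flip ?chart_inv_base_flip// ?b0//.
by rewrite nrm2_base_flip mulf_neq0 ?f0// expfz_neq0// nrm2_eq0 b0.
Qed.

(** This one relation shows that a flip keeps both the half-space and its bounding hyperplane. *)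
Lemma flip_height i j i' j' x : transition_dom i j i' j' x ->
  exists2 m, 0 <= m & height (flip i j i' j' x) = m * height x.
Proof.
move=> Ux; rewrite /flip; case: (i == i'); case: (j == j').
- by exists 1; rewrite ?mul1r.
- exists ((nrm2 (fibre x) - height x) ^- 2); first by rewrite invr_ge0 sqr_ge0.
  by rewrite /fibre_flip height_row5 mulrC.
- exists (nrm2 (base x) ^ (if j then - k else k)); first by rewrite exprz_ge0 ?nrm2_ge0.
  by rewrite /base_flip height_row5.
- set y := base_flip _ x.
  exists (nrm2 (base x) ^ (if j then - k else k) / (nrm2 (fibre y) - height y) ^+ 2).
    by rewrite mulr_ge0 ?exprz_ge0 ?nrm2_ge0// invr_ge0 sqr_ge0.
  by rewrite /fibre_flip height_row5 {1}/y /base_flip height_row5 mulrAC.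
Qed.

Lemma flip_halfspace i j i' j' x : transition_dom i j i' j' x -> halfspace x ->
  halfspace (flip i j i' j' x).
Proof.
move=> /flip_height[m m0 xm] x0; rewrite /halfspace /= -/(height _) xm.
exact: mulr_ge0_le0.
Qed.

(** [x] and [flip i j i' j' x] are coordinates of the same point, so the target chart returns the
    latter once the weight there is nonzero; the half-space ensures this. *)
Lemma transitionE i j i' j' x : transition_dom i j i' j' x -> halfspace x ->
  transition i j i' j' x = flip i j i' j' x.
Proof.
move=> Ux x0; rewrite /transition /= -(chart_inv_flip Ux) chart_invK//.
by rewrite gt_eqF// chart_weight_gt0//; exact: flip_halfspace.
Qed.

Lemma positive_flip i j i' j' x : transition_dom i j i' j' x ->
  positive_at (flip i j i' j') x.
Proof.
move=> Ux; have b0 := transition_dom_base Ux; have f0 := transition_dom_fibre Ux.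
rewrite /flip; case: (eqVneq i i') b0 => [_ _|ii' /(_ isT) b0];
  case: (eqVneq j j') f0 => [_ _|jj' /(_ isT) f0].
- exact: positive_at_id.
- exact: positive_fibre_flip.
- exact: positive_base_flip.
- apply: (positive_at_comp (positive_base_flip _ b0)); apply: positive_fibre_flip.
  by rewrite nrm2_base_flip mulf_neq0 ?f0// expfz_neq0// nrm2_eq0.
Qed.

(** Equality with the flip on the half-space alone would not control the chosen Jacobian at its
    boundary. Nonvanishing of the target weight is an open condition, so the equality extends to a
    full neighbourhood. *)
Lemma positive_transition i j i' j' x : transition_dom i j i' j' x -> halfspace x ->
  positive_at (transition i j i' j') x.
Proof.
move=> Ux x0; have pf := positive_flip Ux.
have [df _] := pf; apply: positive_at_near pf.
have Un : \near x, transition_dom i j i' j' x.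
  by apply: open_nbhs_nbhs; split => //; exact: transition_dom_open.
have Wn : \forall y \near x, chart_weight k i' j' (flip i j i' j' y) != 0.
  have nW : nbhs (flip i j i' j' x) [set y | chart_weight k i' j' y != 0].
    apply: open_nbhs_nbhs; split; first exact: chart_weight_open.
    by rewrite /= gt_eqF// chart_weight_gt0//; exact: flip_halfspace.
  exact: (differentiable_continuous df nW).
near=> y; have Uy : transition_dom i j i' j' y by near: y.
rewrite /transition /= -(chart_inv_flip Uy) chart_invK//; near: y; exact: Wn.
Unshelve. all: by end_near. Qed.

End Transitions.

(** * Reversal of the orientation by conjugating charts with a reflection *)

Section Reflection.
Context {R : realType}.

Definition reflect_if (pos : bool) (y : 'rV[R]_4) : 'rV[R]_4 :=
  if pos then y else reflect_fst y.

(* The disc bundle is reoriented by reflecting the first coordinate of the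
   boundary, as [reflect_chart] does. *)
Definition mirror (pos : bool) (x : 'rV[R]_(1 + 4)) : 'rV[R]_(1 + 4) :=
  row_mx (lsubmx x) (reflect_if pos (rsubmx x)).

Lemma reflect_ifK pos : involutive (reflect_if pos).
Proof.
case: pos => // y; apply/rowP => i; rewrite !mxE.
by case: (_ == _); rewrite ?opprK.
Qed.

Lemma rsubmx_mirror pos x : rsubmx (mirror pos x) = reflect_if pos (rsubmx x).
Proof. by rewrite /mirror row_mxKr. Qed.

Lemma mirror_row_mx pos (h : 'rV[R]_1) y : mirror pos (row_mx h y) = row_mx h (reflect_if pos y).
Proof. by rewrite /mirror row_mxKl row_mxKr. Qed.

Lemma mirrorK pos : involutive (mirror pos).
Proof. by move=> x; rewrite {1}/mirror rsubmx_mirror reflect_ifK /mirror row_mxKl hsubmxK. Qed.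

Lemma mirrorE pos x j :
  mirror pos x 0 j = (if ~~ pos && (j == 1%N :> nat) then - 1 else 1) * x 0 j.
Proof.
case: (@split_ordP 1 4 j) => j' ->.
  by rewrite row_mxEl mxE ord1 andbF mul1r.
rewrite row_mxEr; case: pos; rewrite !mxE ?mul1r//=.
by rewrite -[(1 + j')%N]/(j'.+1) eqSS; case: (_ == _); rewrite ?mulN1r ?mul1r.
Qed.

Lemma height_mirror pos x : height (mirror pos x) = height x.
Proof. by rewrite /height mirrorE andbF mul1r. Qed.

Lemma halfspace_mirror pos x : halfspace (mirror pos x) <-> halfspace x.
Proof. by rewrite /halfspace /= -!/(height _) height_mirror. Qed.

Lemma elementary_mirror pos : elementary_rV setT (mirror pos).
Proof.
move=> j; under eq_fun do rewrite mirrorE.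
by apply: elementaryM; [exact: elementary_cst|exact: elementary_coord].
Qed.

(** The Jacobian matrix of [mirror] is constant and squares to the identity, so its determinant
    occurs twice and cancels. *)
Lemma positive_at_mirror pos (f : 'rV[R]_(1 + 4) -> 'rV[R]_(1 + 4)) x :
  positive_at f (mirror pos x) -> positive_at (mirror pos \o (f \o mirror pos)) x.
Proof.
move=> [df Jf]; have dr y := elementary_differentiable openT (elementary_mirror pos) (I : setT y).
pose s (j : 'I_5) : R := if ~~ pos && (j == 1%N :> nat) then - 1 else 1.
have Jr y : 'J (mirror pos) y = \matrix_(i, j) (s j * (i == j)%:R).
  apply/matrixP => i j; rewrite [RHS]mxE; apply: (jacobian_affine (dr y)) => h.
  by rewrite !mirrorE !mxE eqxx /= [j == i]eq_sym addrC -/(s j) mulrDr mulrCA.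
have drr := differentiable_comp (dr x) (dr (mirror pos x)).
have JK : 'J (mirror pos) x *m 'J (mirror pos) x = 1%:M.
  rewrite {2}Jr -(Jr (mirror pos x)) -(jacobian_comp (dr x) (dr (mirror pos x))).
  apply/matrixP => i j; rewrite [RHS]mxE; apply: (jacobian_affine drr) => h.
  by rewrite /= !mirrorK !mxE eqxx /= [j == i]eq_sym addrC.
have dfr := differentiable_comp (dr x) df.
split; first exact: differentiable_comp dfr (dr _).
have := congr1 determinant JK; rewrite det_mulmx det1 => dJ.
have E1 := jacobian_comp dfr (dr _); have E2 := jacobian_comp (dr x) df.
rewrite E1 E2 2!det_mulmx (Jr ((f \o mirror pos) x)) -(Jr x) mulrAC dJ mul1r.
exact: Jf.
Qed.

End Reflection.

(** * The disc bundle as a manifold with torus action *)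

Section DiscBundle.
Context {R : realType}.
Local Notation C := (R[i]^o).
Context (k : int) (pos : bool).

(** Positive semidefinite and nonzero: if [a] and [c] vanish, so does [b], hence it suffices to
    demand a positive trace. *)
Definition nonneg_form (a : R) (b : C) (c : R) :=
  [/\ 0 <= a, 0 <= c, nrm2 b <= a * c & 0 < a + c].

Definition disc_set : set 'rV[R]_10 :=
  [set p | exists z a b c, [/\ z != 0, nonneg_form a b c & p = embed k z a b c]].

Definition disc_chart (i j : bool) : chart R 'rV[R]_10 (1 + 4) :=
  Chart (disc_set `&` [set p | chart_open i j p])
    (mirror pos \o chart_map k i j) (chart_inv k i j \o mirror pos).

Definition disc_bundle : mfd R (1 + 4) :=
  Mfd disc_set [set c | exists i j, c = disc_chart i j].

Lemma weight_gt0 z a b c : z != 0 -> nonneg_form a b c -> 0 < weight k z a c.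
Proof.
move=> /hsize_gt0 z0 [a0 c0 _ ac]; rewrite /weight.
have N0 : 0 < hsize z ^ (- k) by exact: exprz_gt0.
move: a0; rewrite le_eqVlt => /orP[/eqP a0|a0].
  by rewrite -a0 mul0r add0r; rewrite -a0 add0r in ac.
by rewrite ltr_pwDl// mulr_gt0.
Qed.

Lemma chart_open_embed i j z a b c : z != 0 -> nonneg_form a b c ->
  chart_open i j (embed k z a b c) <-> entry i z != 0 /\ (if j then c else a) != 0.
Proof.
move=> z0 F; have t0 := weight_gt0 z0 F; have N0 := hsize_gt0 z0.
have zE : (pnorm i (embed k z a b c) == 0) = (entry i z == 0).
  by rewrite pnorm_embed mulf_eq0 invr_eq0 (gt_eqF N0) orbF nrm2_eq0.
have dE : (pdiag j (embed k z a b c) == 0) = ((if j then c else a) == 0).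
  rewrite pdiag_embed mulf_eq0 invr_eq0 (gt_eqF t0) orbF; case: j {zE} => //.
  by rewrite mulf_eq0 (gt_eqF (exprz_gt0 _ N0)) orbF.
by rewrite /chart_open zE dE.
Qed.

Lemma chart_map_disc i j p : disc_set p -> chart_open i j p ->
  halfspace (chart_map k i j p) /\ chart_inv k i j (chart_map k i j p) = p.
Proof.
move=> [z [a [b [c [z0 F ->]]]]] /(chart_open_embed _ _ z0 F)[zi0 d0].
have t0 : weight k z a c != 0 by rewrite gt_eqF// (weight_gt0 z0 F).
have N0 : hsize z != 0 by rewrite gt_eqF// hsize_gt0.
split; last exact: chart_mapK.
case: F => a0 c0 bac _; rewrite chart_map_embed//; apply: point5_halfspace => //.
  by rewrite mulr_ge0// exprz_ge0// nrm2_ge0.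
by rewrite nrm2M nrm2Xz mulrAC ler_wpM2r ?exprz_ge0 ?nrm2_ge0.
Qed.

Lemma affine0 i (u : C) : affine i u != 0.
Proof. by rewrite -hsize_eq0 affine_neq0. Qed.

(** A nonpositive height means [nrm2 (fibre x) <= s], which is nonnegativity of the form with
    diagonal entries [s] and 1. *)
Lemma chart_inv_disc i j x : halfspace x ->
  disc_set (chart_inv k i j x) /\ chart_open i j (chart_inv k i j x).
Proof.
move=> x0; rewrite /chart_inv; set s := nrm2 _ - _; set a := if j then s else 1.
set b := if j then fibre x else _; set c := if j then 1 else s.
have s0 : 0 <= s.
  by rewrite subr_ge0 (le_trans x0) ?nrm2_ge0.
have vs : nrm2 (fibre x) <= s by rewrite lerBrDr gerDl.
have F : nonneg_form a b c.
  rewrite /a /b /c; case: (j); split=> //.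
  - by rewrite mulr1.
  - by rewrite ltr_wpDl.
  - by rewrite mul1r nrm2_conj.
  - by rewrite ltr_pwDl.
have A0 := affine0 i (base x); split; first by exists (affine i (base x)), a, b, c.
apply/(chart_open_embed _ _ A0 F); rewrite entry_affine oner_neq0; split=> //.
by rewrite /a /c; case: (j); rewrite oner_neq0.
Qed.

Lemma disc_cmap_image i j : cmap (disc_chart i j) @` dom (disc_chart i j) = @halfspace R 4.
Proof.
apply/seteqP; split=> [_ [p [Wp Op] <-]|x x0] /=.
  by apply/halfspace_mirror; have [] := chart_map_disc Wp Op.
have rx0 : halfspace (mirror pos x) by apply/halfspace_mirror.
exists (chart_inv k i j (mirror pos x)); first exact: chart_inv_disc.
by rewrite chart_invK ?mirrorK// gt_eqF// chart_weight_gt0.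
Qed.

Lemma disc_is_chart i j : is_chart (@halfspace R 4) (disc_chart i j : chart R (mtype disc_bundle) _).
Proof.
split.
- by exists [set p | chart_open i j p]; split=> //; exact: chart_open_open.
- by exists setT; split; [exact: openT|rewrite setIT disc_cmap_image].
- by move=> p [Wp Op] /=; rewrite mirrorK; have [] := chart_map_disc Wp Op.
- apply: continuous_in_subspaceT => p /set_mem[Wp Op].
  exact: (elementary_continuous (@chart_open_open R i j) (elementary_rV_comp
    (fun _ _ => I) (elementary_chart_map k i j) (elementary_mirror pos)) Op).
- apply: continuous_in_subspaceT => x; rewrite disc_cmap_image => /set_mem x0.
  have rx0 : halfspace (mirror pos x) by apply/halfspace_mirror.
  apply: continuous_comp.
    exact: (elementary_continuous openT (elementary_mirror pos)).
  apply: (elementary_continuous (@chart_weight_open R k i j) (elementary_chart_inv k i j)).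
  by rewrite /= gt_eqF// chart_weight_gt0.
Qed.

Lemma disc_transition_dom i j i' j' x :
  (cmap (disc_chart i j) @` (dom (disc_chart i j) `&` dom (disc_chart i' j'))) x ->
  transition_dom k i j i' j' (mirror pos x) /\ halfspace (mirror pos x).
Proof.
move=> [p [[Wp Op] [_ O'p]] <-] /=; rewrite mirrorK.
have [p0 pK] := chart_map_disc Wp Op; split=> //; split=> /=.
  by rewrite gt_eqF// chart_weight_gt0.
by rewrite pK.
Qed.

Lemma mirror_transition_dom_open i j i' j' : open (@mirror R pos @^-1` transition_dom k i j i' j').
Proof.
rewrite -[X in open X]setTI; apply: elementary_open; [exact: openT| |exact: elementary_mirror].
exact: transition_dom_open.
Qed.

Lemma elementary_mirror_transition i j i' j' :
  elementary_rV (@mirror R pos @^-1` transition_dom k i j i' j')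
    (mirror pos \o (transition k i j i' j' \o mirror pos)).
Proof.
apply: elementary_rV_comp (fun _ _ => I) _ (elementary_mirror pos).
apply: (elementary_rV_comp (V := transition_dom k i j i' j')) => //.
  by move=> n; exact: elementary_sub (elementary_mirror pos n).
exact: elementary_transition.
Qed.

(** Given [height x <= 0], the last inequality bounds both [nrm2 (fibre x)] and [- height x] by
    1. *)
Definition disc_compact : set 'rV[R]_(1 + 4) :=
  [set x | [/\ height x <= 0, nrm2 (base x) <= 1 & nrm2 (fibre x) - height x <= 1]].

Lemma compact_disc_compact : compact disc_compact.
Proof.
have cl (f : 'rV[R]_(1 + 4) -> R) r : elementary setT f -> closed [set x | f x <= r].
  move=> Tf; apply: (closed_comp _ (@closed_le R r)) => x _.
  by apply: differentiable_continuous; exact: (elementary_diff openT Tf).1.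
have Tb := elementary_nrm2 (elementary_base [set: 'rV[R]_(1 + 4)]).
have Tf := elementary_nrm2 (elementary_fibre [set: 'rV[R]_(1 + 4)]).
have Th := elementary_height [set: 'rV[R]_(1 + 4)].
have clD : closed disc_compact.
  rewrite (_ : disc_compact = [set x | height x <= 0] `&`
    ([set x | nrm2 (base x) <= 1] `&` [set x | nrm2 (fibre x) - height x <= 1])).
    by apply: closedI; [exact: cl|apply: closedI; apply: cl => //; exact: elementaryB].
  by apply/seteqP; split=> x; [case|case=> ? []].
apply: subclosed_compact clD (rV_compact (fun=> @segment_compact R (-1) 1)) _.
move=> x [h0 b1 f1] j /=; rewrite in_itv /= -ler_norml.
have sq (r : R) : r ^+ 2 <= 1 -> `|r| <= 1 by rewrite -real_normK ?num_real// expr_le1.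
have h1 : - x 0 0 <= 1 by rewrite (le_trans _ f1)// lerDr nrm2_ge0.
have f1' : nrm2 (fibre x) <= 1 by rewrite (le_trans _ f1)// lerBrDr gerDl.
rewrite /nrm2 baseE /= in b1; rewrite /nrm2 fibreE /= in f1'.
have -> : x ord0 j = [:: x 0 0; x 0 1; x 0 2; x 0 3; x 0 4]`_j.
  by case: j => -[|[|[|[|[|//]]]]] jlt /=; congr (x _ _); apply/val_inj.
case: j => -[|[|[|[|[|//]]]]] /= _.
- by rewrite ler_norml (le_trans h0)// andbT lerNl.
- by apply: sq; rewrite (le_trans _ b1)// lerDl sqr_ge0.
- by apply: sq; rewrite (le_trans _ b1)// lerDr sqr_ge0.
- by apply: sq; rewrite (le_trans _ f1')// lerDl sqr_ge0.
- by apply: sq; rewrite (le_trans _ f1')// lerDr sqr_ge0.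
Qed.

(** Dividing by the larger entry of z, and then by the larger diagonal entry of the form, leaves
    quotients of modulus at most 1. *)
Lemma disc_cover p : disc_set p ->
  exists i j x, disc_compact x /\ p = chart_inv k i j x.
Proof.
move=> Wp; have [z [a [b [c [z0 F pE]]]]] := Wp.
pose i := nrm2 z.1 <= nrm2 z.2.
have zi : nrm2 (entry (~~ i) z) <= nrm2 (entry i z).
  by rewrite /i; case: (leP (nrm2 z.1)) => //= /ltW.
have ni0 : 0 < nrm2 (entry i z).
  have hz : hsize z = nrm2 (entry i z) + nrm2 (entry (~~ i) z).
    by case: (i) => //; rewrite addrC.
  rewrite lt_def nrm2_ge0 andbT; apply: contraTneq (hsize_gt0 z0) => n0.
  by rewrite hz n0 add0r -leNgt -n0.
(* The diagonal entries are compared in the trivialization with [entry i z = 1], where [a] becomes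
   [A]. *)
pose A := a * nrm2 (entry i z) ^ (- k); pose j := A <= c.
have nk0 : 0 < nrm2 (entry i z) ^ (- k) by exact: exprz_gt0.
have [a0 c0 bac ac] := F.
have d0 : 0 < if j then c else A.
  rewrite /j; case: (leP A c) => [Ac|/(le_lt_trans c0)//].
  rewrite lt_def c0 andbT; apply: contraTneq ac => cE; rewrite cE addr0 -leNgt.
  by rewrite -(pmulr_lle0 _ nk0) -/A -cE.
have zi0 : entry i z != 0 by rewrite -nrm2_gt0.
have Op : chart_open i j p.
  rewrite pE; apply/(chart_open_embed _ _ z0 F); split=> //.
  move: d0; case: (j) => [/gt_eqF->//|]; rewrite /A; apply: contraTneq => ->.
  by rewrite mul0r ltxx.
have [x0 pK] := chart_map_disc Wp Op.
have N0 : hsize z != 0 by rewrite gt_eqF// hsize_gt0.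
have t0 : weight k z a c != 0 by rewrite gt_eqF// (weight_gt0 z0 F).
exists i, j, (chart_map k i j p); split=> //; split=> //.
  rewrite pE chart_map_embed // /point5 rowE5.
  by rewrite nrm2M nrm2V ler_pdivrMr// mul1r.
rewrite pE chart_map_embed // /point5 !rowE5.
rewrite opprB addrC subrK -/A /fib_s; move: d0; rewrite /j.
by case: (leP A c) => [Ac|/ltW cA] d0; rewrite ler_pdivrMr// mul1r.
Qed.

Lemma compact_disc_set : compact disc_set.
Proof.
have cD i j : compact (chart_inv k i j @` disc_compact).
  apply: continuous_compact compact_disc_compact.
  apply: continuous_in_subspaceT => x /set_mem[x0 _ _].
  apply: (elementary_continuous (@chart_weight_open R k i j) (elementary_chart_inv k i j)).
  by rewrite /= gt_eqF// chart_weight_gt0.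
have := compactU (compactU (cD false false) (cD false true))
                 (compactU (cD true false) (cD true true)).
congr compact; apply/seteqP; split=> [p|p /disc_cover[i [j [x [Dx ->]]]]].
  by move=> [[]|[]] [x [x0 _ _] <-]; exact: (chart_inv_disc _ _ x0).1.
by case: i; case: j; [right; right|right; left|left; right|left; left]; exists x.
Qed.

Lemma disc_bundle_compact_oriented : compact_oriented_mfd (@halfspace R 4) disc_bundle.
Proof.
split.
- by apply: subspace_hausdorff; exact: norm_hausdorff.
- exact: compact_disc_set.
- by move=> c [i [j ->]]; exact: disc_is_chart.
- move=> p /disc_cover[i [j [x [[x0 _ _] ->]]]].
  by exists (disc_chart i j); [exists i, j|exact: chart_inv_disc].
- move=> b c [i [j ->]] [i' [j' ->]]; split.
    apply: (elementary_smooth_on (@mirror_transition_dom_open i j i' j') _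
      (elementary_mirror_transition i j i' j')) => // x /disc_transition_dom[].
    by [].
  apply: (@positive_onP _ _ _ _ _ (mirror pos \o (transition k i j i' j' \o mirror pos)) (fun _ => id)).
    move=> x /disc_transition_dom[Ux x0]; apply: positive_at_mirror.
    exact: positive_transition.
  by [].
Qed.

End DiscBundle.

(** * The torus action on the disc bundle *)

Section TorusAction.
Context {R : realType}.
Local Notation C := (R[i]^o).
Local Open Scope complex_scope.

Lemma continuous_rV (T : topologicalType) n (f : T -> 'rV[R]_n) x :
  (forall j, {for x, continuous (fun t => f t 0 j)}) -> {for x, continuous f}.
Proof.
move=> cf A [P nP sPA]; have : \forall t \near x, forall j, P 0 j (f t 0 j).
  by apply: filter_forall => j; exact: (cf j _ (nP 0 j)).
by apply: filterS => t Pt; apply: sPA => i j; rewrite ord1.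
Qed.

Lemma continuous_row_mx m n :
  continuous (fun q : 'rV[R]_m * 'rV[R]_n => row_mx q.1 q.2).
Proof.
move=> q; apply: continuous_rV => j; case: (@split_ordP m n j) => j' ->.
  rewrite (_ : (fun t : _ * _ => _) = (fun x : 'rV[R]_m => x 0 j') \o fst).
    by apply: continuous_comp; [exact: cvg_fst|exact: coord_continuous].
  by apply/funext => t; rewrite row_mxEl.
rewrite (_ : (fun t : _ * _ => _) = (fun x : 'rV[R]_n => x 0 j') \o snd).
  by apply: continuous_comp; [exact: cvg_snd|exact: coord_continuous].
by apply/funext => t; rewrite row_mxEr.
Qed.

Lemma expiD (a b : R) : expi (a + b) = expi a * expi b :> C.
Proof.
by apply/eqP; rewrite eq_complex /= mulrDr cosD sinD [X in _ && (X == _)]addrC !eqxx.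
Qed.

Lemma expi0 : expi 0 = 1 :> C.
Proof. by rewrite /expi mulr0 cos0 sin0. Qed.

Lemma expi1 : expi 1 = 1 :> C.
Proof. by rewrite /expi mulr1 mulr_natl cos2pi sin2pi. Qed.

Lemma expiN (a : R) : expi (- a) = (expi a)^-1 :> C.
Proof. by apply: (mulfI (expi_neq0 a)); rewrite -expiD subrr expi0 mulfV ?expi_neq0. Qed.

Lemma expiXz (a : R) (m : int) : (expi a : C) ^ m = expi (m%:~R * a).
Proof.
have expX n : (expi a : C) ^+ n = expi (n%:R * a).
  elim: n => [|n IHn]; first by rewrite expr0 mul0r expi0.
  by rewrite exprS IHn -expiD -natr1 mulrDl mul1r addrC.
case: m => n; first exact: expX.
by rewrite NegzE -exprnN expX -expiN mulrNz mulNr.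
Qed.

Lemma expi_int (m : int) : expi m%:~R = 1 :> C.
Proof. by rewrite -[m%:~R]mulr1 -expiXz expi1 exp1rz. Qed.

Lemma nrm2_expi (a : R) : nrm2 (expi a : C) = 1.
Proof. exact: cos2Dsin2. Qed.

Lemma elementary_expi m (U : set 'rV[R]_m) f : elementary U f ->
  elementaryC U (fun x => expi (f x)).
Proof.
move=> Uf; have Upf := elementaryM (elementary_cst U (2 * pi)) Uf.
by split; [exact: elementary_cos|exact: elementary_sin].
Qed.

Context (k : int).

(** A linear action on all of R^10 by characters: [z.2 * conjc z.1] turns with t_1, [b * hpow k z.1]
    with t_2, and [b * hpow k z.2] with t_2 - k t_1, because [hpow k] raises a phase to the power
    [- k]. *)
Definition disc_action (t : 'rV[R]_2) (p : 'rV[R]_10) : 'rV[R]_10 :=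
  let b := expi (t 0 0) * pbase false p in
  let f0 := expi (t 0 1) * pfib false p in
  let f1 := expi (t 0 1 - k%:~R * t 0 0) * pfib true p in
  \row_n [:: p 0 0; p 0 1; complex.Re b; complex.Im b; p 0 4; p 0 5;
             complex.Re f0; complex.Im f0; complex.Re f1; complex.Im f1]`_n.

Lemma hpow_expi (a : R) : hpow k (expi a) = expi (- (k%:~R * a)).
Proof.
by rewrite hpowE ?expi_neq0// nrm2_expi expr1n mulr1 expiXz mulrNz mulNr.
Qed.

(** The rotation of [b] is the one that rotating [w.1] induces on [w.1 * conjc w.2]; this yields
    equivariance on the boundary. *)
Lemma disc_action_embed t z a b c : disc_action t (embed k z a b c) =
  embed k (z.1, expi (t 0 0) * z.2) a (expi (t 0 1) * b) c.
Proof.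
have hsE : hsize (z.1, expi (t 0 0) * z.2 : C) = hsize z.
  by rewrite /hsize /= nrm2M nrm2_expi mul1r.
have wE : weight k (z.1, expi (t 0 0) * z.2 : C) a c = weight k z a c.
  by rewrite /weight hsE.
have ReM (u : C) (r : R) : complex.Re (u * r%:C) = complex.Re u * r.
  by case: u => x y /=; rewrite mulr0 subr0.
have ImM (u : C) (r : R) : complex.Im (u * r%:C) = complex.Im u * r.
  by case: u => x y /=; rewrite mulr0 add0r.
apply/rowP => n; rewrite /disc_action pbase_embed !pfib_embed mxE [RHS]mxE hsE wE.
rewrite !mulrA !ReM !ImM /= hpowM hpow_expi expiD nrm2M nrm2_expi mul1r !mxE /=.
rewrite -!mulrA.
have -> : expi (t 0 1) * (expi (- (k%:~R * t 0 0)) * (b * hpow k z.2)) =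
    expi (t 0 1) * (b * (expi (- (k%:~R * t 0 0)) * hpow k z.2)) :> C by ring.
by [].
Qed.

Lemma disc_action_set t p : disc_set k p -> disc_set k (disc_action t p).
Proof.
move=> [z [a [b [c [z0 [a0 c0 bac ac] ->]]]]]; rewrite disc_action_embed.
exists (z.1, expi (t 0 0) * z.2), a, (expi (t 0 1) * b), c; split=> //.
  rewrite -hsize_eq0 /hsize /= nrm2M nrm2_expi mul1r -/(hsize z) hsize_eq0//.
by split=> //; rewrite nrm2M nrm2_expi mul1r.
Qed.

Lemma complexK (u : C) : Complex (complex.Re u) (complex.Im u) = u.
Proof. by case: u. Qed.

Lemma pbase_action t p : pbase false (disc_action t p) = expi (t 0 0) * pbase false p.
Proof. by rewrite {1}/pbase !mxE; exact: complexK. Qed.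

Lemma pfib0_action t p : pfib false (disc_action t p) = expi (t 0 1) * pfib false p.
Proof. by rewrite {1}/pfib !mxE; exact: complexK. Qed.

Lemma pfib1_action t p : pfib true (disc_action t p) =
  expi (t 0 1 - k%:~R * t 0 0) * pfib true p.
Proof. by rewrite {1}/pfib !mxE; exact: complexK. Qed.

Lemma disc_actionD s t p : disc_action (s + t) p = disc_action s (disc_action t p).
Proof.
apply/rowP => n; rewrite {1 2}/disc_action pbase_action pfib0_action pfib1_action.
rewrite !mulrA -!expiD !mxE /=.
rewrite (_ : s 0 1 + t 0 1 - k%:~R * (s 0 0 + t 0 0) =
  s 0 1 - k%:~R * s 0 0 + (t 0 1 - k%:~R * t 0 0)); last by ring.
by case: n => -[|[|[|[|[|[|[|[|[|[|//]]]]]]]]]].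
Qed.

Lemma disc_action_int (m : 'rV[int]_2) p : disc_action (map_mx intr m) p = p.
Proof.
apply/rowP => n; rewrite /disc_action !mxE -intrM -intrB !expi_int !mul1r /=.
by case: n => -[|[|[|[|[|[|[|[|[|[|//]]]]]]]]]] nlt /=; congr (p _ _); apply/val_inj.
Qed.

Definition disc_action2 (v : 'rV[R]_(2 + 10)) := disc_action (lsubmx v) (rsubmx v).

Lemma elementary_disc_action : elementary_rV setT disc_action2.
Proof.
have el (j : 'I_2) : elementary setT (fun v : 'rV[R]_(2 + 10) => lsubmx v 0 j).
  by under eq_fun do rewrite mxE; exact: elementary_coord.
have er (j : 'I_10) : elementary setT (fun v : 'rV[R]_(2 + 10) => rsubmx v 0 j).
  by under eq_fun do rewrite mxE; exact: elementary_coord.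
have eb : elementaryC setT (fun v : 'rV[R]_(2 + 10) => pbase false (rsubmx v)).
  by split; [exact: (er 2)|exact: (er 3)].
have ef i : elementaryC setT (fun v : 'rV[R]_(2 + 10) => pfib i (rsubmx v)).
  by case: i; split; [exact: (er 8)|exact: (er 9)|exact: (er 6)|exact: (er 7)].
have [B1 B2] := elementaryCM (elementary_expi (el 0)) eb.
have [F1 F2] := elementaryCM (elementary_expi (el 1)) (ef false).
have [G1 G2] := elementaryCM (elementary_expi (elementaryB (el 1)
  (elementaryM (elementary_cst setT k%:~R) (el 0)))) (ef true).
move=> j; rewrite /disc_action2 /disc_action.
by case: j => -[|[|[|[|[|[|[|[|[|[|//]]]]]]]]]] jlt;
  under eq_fun do rewrite mxE /=.
Qed.

Lemma disc_torus_action pos : @torus_action R 2 _ (disc_bundle k pos) disc_action.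
Proof.
split; [by move=> s t p _; exact: disc_actionD|by move=> m p _; exact: disc_action_int|].
split.
- by move=> [t p] [_ Wp] /=; exact: disc_action_set.
- apply: continuous_subspaceT => q.
  rewrite (_ : (fun q => _) = disc_action2 \o (fun q => row_mx q.1 q.2)).
    apply: continuous_comp; first exact: continuous_row_mx.
    exact: (elementary_continuous openT elementary_disc_action).
  by apply/funext => r; rewrite /disc_action2 /= row_mxKl row_mxKr.
- move=> _ c [_ [i [j ->]] <-] [i' [j' ->]].
  (* In charts the action factors through R^10, where it is elementary everywhere; only the two
     charts restrict the domain. *)
  pose lift (v : 'rV[R]_(2 + 5)) : 'rV[R]_(2 + 10) :=
    row_mx (lsubmx v) (chart_inv k i j (mirror pos (rsubmx v))).
  pose r (v : 'rV[R]_(2 + 5)) := mirror pos (rsubmx v : 'rV[R]_(1 + 4)).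
  pose U1 := r @^-1` [set x | chart_weight k i j x != 0].
  pose V := disc_action2 @^-1` [set p | chart_open i' j' p].
  have Tr : elementary_rV setT r.
    apply: (elementary_rV_comp (fun _ _ => I) _ (elementary_mirror pos)) => n.
    by under eq_fun do rewrite mxE; exact: elementary_coord.
  have oU1 : open U1.
    rewrite -[X in open X]setTI; apply: elementary_open Tr; first exact: openT.
    exact: chart_weight_open.
  have oV : open V.
    rewrite -[X in open X]setTI; apply: elementary_open elementary_disc_action.
      exact: openT.
    exact: chart_open_open.
  have Ul : elementary_rV U1 lift.
    move=> n; rewrite /lift; case: (@split_ordP 2 10 n) => n' ->.
      by under eq_fun do rewrite row_mxEl mxE; exact: elementary_coord.
    under eq_fun do rewrite row_mxEr.
    apply: (elementary_rV_comp (g := r) _ _ (elementary_chart_inv k i j)) => //.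
    by move=> m; exact: elementary_sub (Tr m).
  apply: (@elementary_smooth_on _ _ _ _ (U1 `&` lift @^-1` V) _
    (mirror pos \o (chart_map k i' j' \o (disc_action2 \o lift)))).
  - exact: elementary_open.
  - move=> _ [[t p] [[_ [Wp Op]] [_ O'p]] <-] /=.
    have [p0 pK] := chart_map_disc Wp Op; split.
      by rewrite /U1 /r /= row_mxKr mirrorK gt_eqF// chart_weight_gt0.
    by rewrite /V /lift /= /disc_action2 !row_mxKr !row_mxKl mirrorK pK.
  - apply: (elementary_rV_comp (fun _ _ => I) _ (elementary_mirror pos)).
    apply: (elementary_rV_comp (V := [set p | chart_open i' j' p]));
      [by move=> v []| |exact: elementary_chart_map].
    apply: (elementary_rV_comp (fun _ _ => I) _ elementary_disc_action) => n.
    by apply: elementary_sub (Ul n) => v [].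
  - by move=> v _; rewrite /= /disc_action2 /lift row_mxKl row_mxKr.
Qed.

End TorusAction.

(** * The Hirzebruch surface as the boundary *)

Section HirzebruchEmbedding.
Context {R : realType}.
Local Notation C := (R[i]^o).
Local Open Scope complex_scope.

(** The norm of [R[i]^o] takes values in [R[i]], so radii are complex numbers and a real one has to
    be embedded. *)
Lemma continuous_Re : continuous (@complex.Re R : C -> R).
Proof.
move=> x; apply/(@cvgrPdist_lt _ _ _ _ (nbhs_filter x)) => e e0; have e0' : 0 < (e%:C : C) by rewrite ltcR.
have xe : \forall y \near x, `|x - y| < (e%:C : C).
  exact: (@cvgrPdist_lt _ C _ _ (nbhs_filter x) id x).1 (@cvg_id _ (nbhs x)) _ e0'.
apply: filterS xe => y xy; rewrite -[_ - _]/(complex.Re x + - complex.Re y).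
have -> : complex.Re x + - complex.Re y = complex.Re (x - y) by case: (x) (y) => ? ? [].
by rewrite -ltcR (le_lt_trans (normc_ge_Re _)).
Qed.

Lemma continuous_Im : continuous (@complex.Im R : C -> R).
Proof.
rewrite (_ : @complex.Im R = @complex.Re R \o (fun u : C => (Complex 0 (-1) : C) * u)).
  move=> x; apply: continuous_comp; [exact: mulrl_continuous|exact: continuous_Re].
by apply/funext => -[a b] /=; rewrite mul0r sub0r mulN1r opprK.
Qed.

Lemma continuous_Complex (T : topologicalType) (a b : T -> R) x :
  {for x, continuous a} -> {for x, continuous b} ->
  {for x, continuous (fun t => Complex (a t) (b t) : C)}.
Proof.
move=> ca cb; apply/(@cvgrPdist_lt _ _ _ _ (nbhs_filter x)) => e e0.
have eE : e = (complex.Re e)%:C by move: e0; rewrite ltcE => /andP[/eqP]; case: (e) => ? ? /= ->.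
have r0 : 0 < complex.Re e / 2 by move: e0; rewrite eE ltcR => e0; rewrite divr_gt0.
move/cvgrPdist_lt : ca => /(_ _ r0) an; move/cvgrPdist_lt : cb => /(_ _ r0) bn.
near=> t; rewrite eE -[X in `|X|]/(Complex (a x - a t) (b x - b t)).
rewrite [Complex _ _]complexE /= (le_lt_trans (ler_normD _ _))//.
have ni : `|Complex 0 1 : R[i]| = 1 by rewrite normc_def /= expr0n expr1n add0r sqrtr1.
rewrite normrM ni mul1r.
have nR (r : R) : `|r%:C| = `|r|%:C :> C.
  by rewrite normc_def /= expr0n addr0 sqrtr_sqr.
rewrite !nR -rmorphD ltcR [ltRHS](splitr) ltrD//; near: t; [exact: an|exact: bn].
Unshelve. all: by end_near. Qed.

(** Real coordinates of a representative: through them the embedding of the quotient is continuous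
    because it is elementary on part of R^8. *)
Definition real8 (v : @nonzero R * @nonzero R) : 'rV[R]_8 :=
  let z := \val v.1 in let w := \val v.2 in
  \row_n [:: complex.Re z.1; complex.Im z.1; complex.Re z.2; complex.Im z.2;
             complex.Re w.1; complex.Im w.1; complex.Re w.2; complex.Im w.2]`_n.

Lemma continuous_real8 : continuous real8.
Proof.
have cval (p : @nonzero R * @nonzero R -> @nonzero R) (q : C * C -> C) (r : C -> R) :
    continuous p -> continuous q -> continuous r ->
    continuous (fun v => r (q (\val (p v)))).
  move=> cp cq cr v; apply: (@continuous_comp _ _ _ (fun v => q (\val (p v))) r); last exact: cr.
  apply: (@continuous_comp _ _ _ (fun v => \val (p v)) q); last exact: cq.
  apply: (@continuous_comp _ _ _ p val); first exact: cp.
  exact: initial_continuous.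
have c1 (T U : topologicalType) : continuous (@fst T U) by move=> ?; exact: cvg_fst.
have c2 (T U : topologicalType) : continuous (@snd T U) by move=> ?; exact: cvg_snd.
have cR := continuous_Re; have cI := continuous_Im.
pose val1 (r : C -> R) q (v : @nonzero R * @nonzero R) := r (q (\val v.1)).
pose val2 (r : C -> R) q (v : @nonzero R * @nonzero R) := r (q (\val v.2)).
have rE (j : 'I_8) : (fun v => real8 v 0 j) = nth (fun=> 0)
    [:: val1 (@complex.Re R) fst; val1 (@complex.Im R) fst;
        val1 (@complex.Re R) snd; val1 (@complex.Im R) snd;
        val2 (@complex.Re R) fst; val2 (@complex.Im R) fst;
        val2 (@complex.Re R) snd; val2 (@complex.Im R) snd] j.
  by apply/funext => v; rewrite mxE; case: j => -[|[|[|[|[|[|[|[|//]]]]]]]].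
have c8 (j : 'I_8) : continuous (fun v => real8 v 0 j).
  rewrite rE; case: j => -[|[|[|[|[|[|[|[|//]]]]]]]] jlt /=;
    [exact: (cval fst fst _ (c1 _ _) (c1 _ _) cR)
    |exact: (cval fst fst _ (c1 _ _) (c1 _ _) cI)
    |exact: (cval fst snd _ (c1 _ _) (c2 _ _) cR)
    |exact: (cval fst snd _ (c1 _ _) (c2 _ _) cI)
    |exact: (cval snd fst _ (c2 _ _) (c1 _ _) cR)
    |exact: (cval snd fst _ (c2 _ _) (c1 _ _) cI)
    |exact: (cval snd snd _ (c2 _ _) (c2 _ _) cR)
    |exact: (cval snd snd _ (c2 _ _) (c2 _ _) cI)].
by move=> v; apply: continuous_rV => j; exact: c8.
Qed.

Context (k : int).

Definition rank1_embed (z w : C * C) : 'rV[R]_10 :=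
  embed k z (nrm2 w.1) (w.1 * conjc w.2) (nrm2 w.2).

Definition hirz_embed (q : @hirz_space R k) : 'rV[R]_10 :=
  rank1_embed (\val (repr q).1) (\val (repr q).2).

Lemma rank1_form (w : C * C) : w != 0 ->
  nonneg_form (nrm2 w.1) (w.1 * conjc w.2) (nrm2 w.2).
Proof.
by move=> w0; split; rewrite ?nrm2_ge0// ?nrm2M ?nrm2_conj//; exact: hsize_gt0.
Qed.

Lemma nonzero_neq0 (z : @nonzero R) : \val z != 0.
Proof. by have := set_mem (valP z). Qed.

(** Scaling [w] by [m] multiplies [w w^*] by the squared modulus of [m], a case of [embed_scale]. *)
Lemma rank1_embed_rel v v' : hirz_rel k v v' ->
  rank1_embed (\val v'.1) (\val v'.2) = rank1_embed (\val v.1) (\val v.2).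
Proof.
move=> [l [m [l0 m0 -> ->]]]; rewrite /rank1_embed /=.
rewrite -[RHS](@embed_scale _ _ l (nrm2 m))// ?nrm2_eq0//; last first.
  by rewrite hsize_eq0 nonzero_neq0.
rewrite !nrm2M nrm2Xz; congr embed.
by rewrite conjcM nrm2E; ring.
Qed.

Lemma hirz_classP (v v' : @nonzero R * @nonzero R) : hirz_class k v = hirz_class k v' <-> hirz_rel k v v'.
Proof.
split=> [vv'|vv'].
  by have /eqmodP/asboolP := vv'.
by apply/eqmodP/asboolP.
Qed.

Lemma hirz_class_repr (q : @hirz_space R k) : hirz_class k (repr q) = q.
Proof. exact: reprK. Qed.

Lemma hirz_embed_class v : hirz_embed (hirz_class k v) =
  rank1_embed (\val v.1) (\val v.2).
Proof.
rewrite /hirz_embed -(@rank1_embed_rel (repr (hirz_class k v)) v)//.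
by apply/hirz_classP; rewrite hirz_class_repr.
Qed.

Lemma continuous_hirz_embed : continuous hirz_embed.
Proof.
apply/quotient_continuous.
pose z1 (x : 'rV[R]_8) : C := Complex (x 0 0) (x 0 1).
pose z2 (x : 'rV[R]_8) : C := Complex (x 0 2) (x 0 3).
pose w1 (x : 'rV[R]_8) : C := Complex (x 0 4) (x 0 5).
pose w2 (x : 'rV[R]_8) : C := Complex (x 0 6) (x 0 7).
pose F x := rank1_embed (z1 x, z2 x) (w1 x, w2 x).
have cE (u : C) : Complex (complex.Re u) (complex.Im u) = u by case: u.
have FE v : hirz_embed (hirz_class k v) = F (real8 v).
  rewrite hirz_embed_class /F /z1 /z2 /w1 /w2 /real8 !mxE /= !cE.
  by rewrite -!surjective_pairing.
rewrite (_ : _ \o _ = F \o real8); last by apply/funext => v; exact: FE.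
have eC (i j : 'I_8) U : elementaryC U (fun x => Complex (x 0 i) (x 0 j)).
  by split; exact: elementary_coord.
pose U0 := [set x | hsize (z1 x, z2 x) != 0].
have oU0 : open U0.
  apply: elementary_neq0_open.
  by apply: elementaryD; apply: elementary_nrm2; exact: eC.
pose wt x := weight k (z1 x, z2 x) (nrm2 (w1 x)) (nrm2 (w2 x)).
have ewt : elementary U0 wt.
  apply: elementaryD; last by apply: elementary_nrm2; exact: eC.
  apply: elementaryM; first by apply: elementary_nrm2; exact: eC.
  apply: elementaryXz => //.
  by apply: elementaryD; apply: elementary_nrm2; exact: eC.
pose U := U0 `&` [set x | wt x != 0].
(* The weight is elementary on [U0] only, so openness is taken relative to [U0], with the weight
   viewed as a row of length 1. *)
have oU : open U.
  have := @elementary_open _ _ 1 U0 [set y : 'rV_1 | y 0 0 != 0] (fun x => const_mx (wt x)) oU0.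
  rewrite (_ : _ `&` _ = U); last by apply/seteqP; split=> x; rewrite /U /= mxE.
  apply; first by apply: elementary_neq0_open; exact: elementary_coord.
  by move=> j; under eq_fun do rewrite mxE.
have eF : elementary_rV U F.
  apply: elementary_embed; try exact: eC.
  - by move=> x [].
  - by move=> x [].
  - by apply: elementary_nrm2; exact: eC.
  - by apply: elementaryCM; [exact: eC|apply: elementaryC_conj; exact: eC].
  - by apply: elementary_nrm2; exact: eC.
move=> v; apply: continuous_comp; first exact: continuous_real8.
apply: (elementary_continuous oU eF).
have [zE wE] : (z1 (real8 v), z2 (real8 v)) = \val v.1 /\ (w1 (real8 v), w2 (real8 v)) = \val v.2.
  by rewrite /z1 /z2 /w1 /w2 /real8 !mxE /= !cE -!surjective_pairing.
have z0 := nonzero_neq0 v.1; have w0 := nonzero_neq0 v.2.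
split; first by rewrite /U0 /= zE hsize_eq0.
rewrite /wt /= zE gt_eqF//; have := weight_gt0 k z0 (rank1_form w0).
by rewrite -wE.
Qed.

End HirzebruchEmbedding.

(** * Identification of the boundary of the disc bundle with the Hirzebruch surface *)

Section Boundary.
Context {R : realType}.
Local Notation C := (R[i]^o).
Local Open Scope complex_scope.
Context (k : int).
Local Notation hirz := (@hirz_space R k).
Local Notation f := (@hirz_embed R k).

Lemma height_lshift (x : 'rV[R]_(1 + 4)) : height x = x 0 (lshift 4 0).
Proof. by rewrite /height; congr (x _ _); apply/val_inj. Qed.

Lemma height_row_mx (h : R) (y : 'rV[R]_4) : height (row_mx (const_mx h) y) = h.
Proof. by rewrite height_lshift row_mxEl mxE. Qed.

Lemma const_mx0 : const_mx 0 = 0 :> 'rV[R]_1.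
Proof. by apply/rowP => n; rewrite !mxE. Qed.

Lemma height0_row_mx (x : 'rV[R]_(1 + 4)) : height x = 0 -> x = row_mx 0 (rsubmx x).
Proof.
move=> x0; rewrite -[LHS]hsubmxK; congr row_mx; apply/rowP => n.
by rewrite !mxE ord1 -[RHS]x0 height_lshift.
Qed.

Lemma entry_nrm2 (j : bool) (w : C * C) :
  (if j then nrm2 w.2 else nrm2 w.1) = nrm2 (entry j w).
Proof. by case: j. Qed.

Lemma disc_set_hirz q : disc_set k (f q).
Proof.
exists (\val (repr q).1), (nrm2 (\val (repr q).2).1),
  ((\val (repr q).2).1 * conjc (\val (repr q).2).2), (nrm2 (\val (repr q).2).2).
by split=> //; [exact: nonzero_neq0|apply: rank1_form; exact: nonzero_neq0].
Qed.

Lemma hirz_domE i j q : hirz_dom i j q <-> chart_open i j (f q).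
Proof.
rewrite /hirz_embed /rank1_embed.
apply: (iff_trans _ (iff_sym (chart_open_embed k i j (nonzero_neq0 _)
  (rank1_form (nonzero_neq0 _))))).
by rewrite entry_nrm2 nrm2_eq0.
Qed.

(** Rank 1 gives height 0, and [fib_w] of [w w^*] is the affine fibre coordinate: the charts of the
    disc bundle extend those of the surface. *)
Lemma chart_map_hirz i j q : hirz_dom i j q ->
  chart_map k i j (f q) = row_mx 0 (hirz_coord i j q).
Proof.
move=> [zi wj]; rewrite /hirz_embed /rank1_embed /hirz_coord.
have z0 := nonzero_neq0 (repr q).1; have w0 := nonzero_neq0 (repr q).2.
move: zi wj z0 w0; move: (\val (repr q).1) (\val (repr q).2) => z w zi wj z0 w0.
have F := rank1_form w0; have t0 := weight_gt0 k z0 F.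
rewrite chart_map_embed ?hsize_eq0 ?(gt_eqF t0)//.
set l := entry i z ^ (- k); rewrite -nrm2Xz -/l; have l0 : l != 0 by exact: expfz_neq0.
set v : C := entry (~~ j) (l * w.1, w.2) / entry j (l * w.1, w.2).
have fw : fib_w j (nrm2 w.1 * nrm2 l) (w.1 * conjc w.2 * l) (nrm2 w.2) = v.
  rewrite /fib_w /v; case: j wj {v} => /= wj.
    rewrite [X in _ = _ * X]invc_nrm2 mulrA; congr (_ * _).
    by rewrite mulrAC [w.1 * l]mulrC.
  rewrite [X in _ = _ * X]invc_nrm2 -nrm2M [w.1 * l]mulrC mulrA; congr (_ * _).
  by rewrite !conjcM conjcK; ring.
have fs : nrm2 v - fib_s j (nrm2 w.1 * nrm2 l) (nrm2 w.2) = 0.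
  rewrite /fib_s /v; case: j wj {v fw} => /= wj;
    by rewrite !nrm2M nrm2V ?nrm2M [nrm2 l * _]mulrC subrr.
rewrite /point5 fw fs /row5; congr row_mx.
Qed.

Lemma hirz_embed_param i j y : f (hirz_param k i j y) = chart_inv k i j (row_mx 0 y).
Proof.
rewrite /hirz_param hirz_embed_class /rank1_embed /chart_inv /=.
rewrite -const_mx0 height_row_mx.
rewrite subr0 /base /fibre row_mxKr; congr embed.
- by case: j; rewrite //= nrm21.
- case: j; last by rewrite -[LHS]/(1 * conjc (complexify y).2) mul1r.
  by rewrite -[LHS]/((complexify y).2 * conjc (1 : C)) conjc1 mulr1.
- by case: j; rewrite //= nrm21.
Qed.

Lemma hirz_coordK i j (q : hirz) : hirz_dom i j q -> hirz_param k i j (hirz_coord i j q) = q.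
Proof.
move=> [zi wj]; rewrite -[RHS]hirz_class_repr; apply/hirz_classP.
rewrite /hirz_coord complexify_realify.
move: zi wj; move: (repr q) => [z' w'] /=; set z := \val z'; set w := \val w' => zi wj.
set l := entry i z; set c := l ^ (- k).
have c0 : c != 0 by exact: expfz_neq0.
have lc : l ^ k * c = 1 by rewrite /c -expfzDr// subrr expr0z.
(* These scalars undo the two normalizations to 1; [c] accounts for the L(k) coordinate having been
   rescaled along with z. *)
exists l, (entry j (c * w.1, w.2)); split=> //.
- by case: j wj => //= wj; rewrite mulf_neq0.
- rewrite -/z /l /=; move: zi; case: (i) => /= zi; rewrite mulr1 mulrC divfK//;
    exact: surjective_pairing.
- have mK (P Q x m : C) : m != 0 -> P * Q = 1 -> m * P * (Q * x / m) = x.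
    by move=> m0 PQ; rewrite -[RHS]mul1r -PQ; field.
  rewrite -/w [LHS]surjective_pairing; case: j wj => /= wj.
    by rewrite mulr1 mK.
  by rewrite mulr1 [c * _ * l ^ k]mulrC mulrA lc mul1r mulrC divfK ?mulf_neq0.
Qed.

Lemma hirz_dom_cover q : exists i j, @hirz_dom R k i j q.
Proof.
have ex (z : C * C) : z != 0 -> exists i, entry i z != 0.
  case: z => a b z0; case: (eqVneq a 0) z0 => [->|a0] z0; last by exists false.
  by exists true; apply: contraNneq z0 => /= ->.
have [i zi] := ex _ (nonzero_neq0 (repr q).1).
by have [j wj] := ex _ (nonzero_neq0 (repr q).2); exists i, j.
Qed.

(** The image of [q] reveals which charts contain [q] and what its coordinates there are. *)
Lemma hirz_embed_inj : injective f.
Proof.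
move=> q q' ff; have [i [j Dq]] := hirz_dom_cover q.
have Dq' : hirz_dom i j q' by apply/hirz_domE; rewrite -ff; apply/hirz_domE.
rewrite -(hirz_coordK Dq) -(hirz_coordK Dq'); congr hirz_param.
have := chart_map_hirz Dq; rewrite ff chart_map_hirz// => /(congr1 (@rsubmx _ _ _ _)).
by rewrite !row_mxKr.
Qed.

Context (pos : bool).
Local Notation W := (disc_bundle k pos).
Local Notation M := (orient pos (@hirzebruch R k)).

Lemma orient_atlas c : matlas M c -> exists i j,
  c = Chart (@hirz_dom R k i j) (reflect_if pos \o @hirz_coord R k i j)
            (@hirz_param R k i j \o reflect_if pos).
Proof.
by case: pos => /=; [move=> [i [j ->]]|move=> [_ [i [j ->]] <-]]; exists i, j.
Qed.

(** A point with coordinates [(0, y)] is the image of the point of the surface with coordinates [y]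
    in the same chart. *)
Lemma boundary_disc_chart i j p : dom (boundary_chart (disc_chart k pos i j)) p <->
  exists2 q, hirz_dom i j q & p = f q.
Proof.
split=> [[[Wp Op] /= h0]|[q Dq ->]]; last first.
  split; first by split; [exact: disc_set_hirz|exact/hirz_domE].
  by rewrite /= -[LHS]/(height _) height_mirror chart_map_hirz// -const_mx0 height_row_mx.
have [p0 pK] := chart_map_disc Wp Op.
have h1 : height (chart_map k i j p) = 0 by rewrite -(height_mirror pos).
have fE : f (hirz_param k i j (rsubmx (chart_map k i j p))) = p.
  by rewrite hirz_embed_param -(height0_row_mx h1).
by exists (hirz_param k i j (rsubmx (chart_map k i j p))); rewrite ?fE//; apply/hirz_domE; rewrite fE.
Qed.

Lemma boundary_set p : Defs.mset (Defs.boundary W) p <-> exists q, p = f q.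
Proof.
split=> [[_ [i [j ->]] /boundary_disc_chart[q _ ->]]|[q ->]]; first by exists q.
have [i [j Dq]] := hirz_dom_cover q.
by exists (disc_chart k pos i j); [exists i, j|apply/boundary_disc_chart; exists q].
Qed.

(** A default value is taken off the image, so continuity and smoothness have to be drawn from
    formulas in charts. *)
Definition hirz_retract (p : 'rV[R]_10) : hirz :=
  if pselect (exists q, p = f q) is left H then sval (cid H) else hirz_param k false false 0.

Lemma hirz_embedK q : hirz_retract (f q) = q.
Proof.
rewrite /hirz_retract; case: pselect => [H|]; last by case; exists q.
by apply: hirz_embed_inj; rewrite -(svalP (cid H)).
Qed.

(** Since matching charts differ by [y |-> (0, y)], this single map expresses both the embedding and
    its inverse in charts. *)
Definition boundary_transition i j i' j' (y : 'rV[R]_4) : 'rV[R]_4 :=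
  rsubmx ((mirror pos \o (transition k i j i' j' \o mirror pos)) (row_mx 0 y)).

Definition boundary_dom i j i' j' : set 'rV[R]_4 :=
  (fun y => row_mx 0 y : 'rV[R]_(1 + 4)) @^-1` (mirror pos @^-1` transition_dom k i j i' j').

Lemma elementary_inclusion m n (U : set 'rV[R]_m) :
  elementary_rV U (fun y => row_mx 0 y : 'rV[R]_(n + m)).
Proof.
move=> j; case: (@split_ordP n m j) => j' ->.
  by under eq_fun do rewrite row_mxEl mxE; exact: elementary_cst.
by under eq_fun do rewrite row_mxEr; exact: elementary_coord.
Qed.

Lemma boundary_dom_open i j i' j' : open (boundary_dom i j i' j').
Proof.
have := elementary_open openT (@mirror_transition_dom_open R k pos i j i' j')
  (@elementary_inclusion 4 1 setT).
by rewrite setTI.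
Qed.

Lemma elementary_boundary_transition i j i' j' :
  elementary_rV (boundary_dom i j i' j') (boundary_transition i j i' j').
Proof.
have er : elementary_rV setT (rsubmx : 'rV[R]_(1 + 4) -> 'rV[R]_4).
  by move=> n; under eq_fun do rewrite mxE; exact: elementary_coord.
have UG : elementary_rV (boundary_dom i j i' j') ((mirror pos \o
    (transition k i j i' j' \o mirror pos)) \o (fun y => row_mx 0 y)).
  apply: elementary_rV_comp (@elementary_mirror_transition R k pos i j i' j') => //.
  exact: elementary_inclusion.
exact: elementary_rV_comp (fun _ _ => I) UG er.
Qed.

Lemma height_transition i j i' j' (h : R) (y : 'rV[R]_4) : h <= 0 ->
  (mirror pos @^-1` transition_dom k i j i' j') (row_mx (const_mx h) y) ->
  exists2 m, 0 <= m &
  height ((mirror pos \o (transition k i j i' j' \o mirror pos)) (row_mx (const_mx h) y)) = m * h.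
Proof.
move=> h0 Uy; have x0 : halfspace (mirror pos (row_mx (const_mx h) y)).
  by apply/halfspace_mirror; rewrite /halfspace /= -[X in X <= 0]/(height _) height_row_mx.
rewrite /= height_mirror transitionE//.
have [m m0 mE] := flip_height Uy; exists m => //.
by rewrite mE height_mirror height_row_mx.
Qed.

(** Orientation descends from the disc bundle: the transition multiplies the height by a nonnegative
    factor, which supplies both side conditions of [positive_at_boundary]. *)
Lemma positive_boundary_transition i j i' j' y : boundary_dom i j i' j' y ->
  positive_at (boundary_transition i j i' j') y.
Proof.
move=> Uy; apply: positive_at_boundary.
- apply: positive_at_mirror; apply: positive_transition => //.
  apply/halfspace_mirror; rewrite /halfspace /= -const_mx0 -[X in X <= 0]/(height _).
  by rewrite height_row_mx.
- have Un : \near y, boundary_dom i j i' j' y.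
    by apply: open_nbhs_nbhs; split => //; exact: boundary_dom_open.
  apply: filterS Un => y' Uy'; rewrite -const_mx0.
  have Uy'' : (mirror pos @^-1` transition_dom k i j i' j') (row_mx (const_mx 0) y').
    by rewrite const_mx0.
  by have [m _ ->] := height_transition (lexx 0) Uy''; rewrite mulr0.
- have cl : continuous (fun h : R => row_mx (const_mx h) y : 'rV[R]_(1 + 4)).
    move=> h; apply: continuous_rV => n; case: (@split_ordP 1 4 n) => n' ->.
      rewrite (_ : (fun t : R => _) = id); first exact: cvg_id.
      by apply/funext => t; rewrite row_mxEl mxE.
    rewrite (_ : (fun t : R => _) = cst (y 0 n')); first exact: cvg_cst.
    by apply/funext => t; rewrite row_mxEr.
  have nU : nbhs (row_mx (const_mx 0) y) (mirror pos @^-1` transition_dom k i j i' j').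
    apply: open_nbhs_nbhs; split; first exact: mirror_transition_dom_open.
    by rewrite const_mx0.
  have nh : \forall h \near (0 : R),
      (mirror pos @^-1` transition_dom k i j i' j') (row_mx (const_mx h) y).
    exact: (cl 0 _ nU).
  apply: filterS nh => h Uh h0.
  have [m m0 mE] := @height_transition i j i' j' h y h0 Uh.
  by rewrite mE; exact: mulr_ge0_le0.
Qed.

End Boundary.

(** * The equivariant oriented diffeomorphism onto the boundary *)

Section NullCobordism.
Context {R : realType}.
Local Notation C := (R[i]^o).
Context (k : int) (pos : bool).
Local Notation hirz := (@hirz_space R k).
Local Notation f := (@hirz_embed R k).
Local Notation g := (@hirz_retract R k).
Local Notation W := (disc_bundle k pos).
Local Notation M := (orient pos (@hirzebruch R k)).

Lemma continuous_affine_point (i : bool) (u : 'rV[R]_4 -> C) :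
  continuous u -> continuous (fun y => affine_point i (u y)).
Proof.
move=> cu; apply: continuous_comp_initial.
rewrite (_ : _ \o _ = (fun y => affine i (u y))) => [y|].
  have c1 : {for y, continuous (fun _ : 'rV[R]_4 => 1 : C)}.
    exact: cst_continuous.
  by case: i; [exact: cvg_pair (cu y) c1|exact: cvg_pair c1 (cu y)].
by apply/funext => y; rewrite /=; case: i.
Qed.

Lemma continuous_hirz_param i j : continuous (@hirz_param R k i j).
Proof.
have c1 : continuous (fun y : 'rV[R]_4 => (complexify y).1 : C).
  by move=> y; apply: continuous_Complex; exact: coord_continuous.
have c2 : continuous (fun y : 'rV[R]_4 => (complexify y).2 : C).
  by move=> y; apply: continuous_Complex; exact: coord_continuous.
pose F (y : 'rV[R]_4) : @nonzero R * @nonzero R :=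
  (affine_point i (complexify y).1, affine_point j (complexify y).2).
have cF : continuous F.
  move=> y.
  have cu := @continuous_affine_point i _ c1 y.
  have cv := @continuous_affine_point j _ c2 y.
  exact: cvg_pair cu cv.
move=> y; apply: (@continuous_comp _ _ _ F (@hirz_class R k)); first exact: cF.
exact: pi_continuous.
Qed.

Lemma boundary_dom_hirz i j i' j' (q : hirz) : hirz_dom i j q -> hirz_dom i' j' q ->
  boundary_dom k pos i j i' j' (reflect_if pos (hirz_coord i j q)) /\
  boundary_transition k pos i j i' j' (reflect_if pos (hirz_coord i j q)) =
  reflect_if pos (hirz_coord i' j' q).
Proof.
move=> Dq Dq'; have [h0 hK] := chart_map_disc (disc_set_hirz q) ((hirz_domE _ _ _).1 Dq).
rewrite /boundary_transition /boundary_dom /= /transition /=.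
rewrite mirror_row_mx reflect_ifK -chart_map_hirz// hK; split.
  split; first by rewrite /= gt_eqF// chart_weight_gt0.
  by rewrite /= hK; exact/hirz_domE.
by rewrite rsubmx_mirror chart_map_hirz// row_mxKr.
Qed.

Lemma boundary_transitionE i j i' j' y : boundary_transition k pos i j i' j' y =
  rsubmx (mirror pos (chart_map k i' j' (f (hirz_param k i j (reflect_if pos y))))).
Proof. by rewrite hirz_embed_param /boundary_transition /= mirror_row_mx. Qed.

(** Near [f q] and within the boundary it agrees with a chart on R^10 followed by the
    parametrization of the surface, a composite that is continuous at [f q]. *)
Lemma continuous_hirz_retract : {within Defs.mset (Defs.boundary W), continuous g}.
Proof.
apply/subspace_continuousP => p /boundary_set[q ->].
have [i [j Dq]] := hirz_dom_cover q; have Op := (hirz_domE _ _ _).1 Dq.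
pose h := @hirz_param R k i j \o (rsubmx \o chart_map k i j : 'rV[R]_10 -> 'rV[R]_4).
have hE q' : hirz_dom i j q' -> h (f q') = q'.
  by move=> Dq'; rewrite /h /= chart_map_hirz// row_mxKr hirz_coordK.
have ch : {for f q, continuous h}.
  apply: continuous_comp; last exact: continuous_hirz_param.
  apply: continuous_comp; last exact: continuous_rsubmx.
  exact: elementary_continuous (@chart_open_open R i j) (elementary_chart_map k i j) Op.
have gE : g (f q) = h (f q) by rewrite hirz_embedK hE.
suff : g @ within (Defs.mset (Defs.boundary W)) (nbhs (f q)) --> h (f q) by rewrite -gE.
apply: cvg_trans (cvg_trans (cvg_app h (cvg_within _)) ch).
apply: near_eq_cvg; apply: filterS (open_nbhs_nbhs (conj (@chart_open_open R i j) Op)).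
move=> p' Op' /boundary_set[q' pE]; rewrite pE in Op' *.
by rewrite hirz_embedK hE//; apply/hirz_domE.
Qed.

Lemma smooth_hirz_embed : smooth_map (M := M) (N := Defs.boundary W) f.
Proof.
split.
- by move=> q _; apply/boundary_set; exists q.
- by apply: continuous_subspaceT; exact: continuous_hirz_embed.
- move=> b c /orient_atlas[i [j ->]] [_ [i' [j' ->]] <-].
  apply: (elementary_smooth_on (@boundary_dom_open R k pos i j i' j') _
    (@elementary_boundary_transition R k pos i j i' j')).
    move=> _ [q [Dq /boundary_disc_chart[q' Dq' /hirz_embed_inj qE]] <-].
    by rewrite -qE in Dq'; have [] := boundary_dom_hirz Dq Dq'.
  by move=> y _; rewrite boundary_transitionE.
Qed.

Lemma smooth_hirz_retract : smooth_map (M := Defs.boundary W) (N := M) g.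
Proof.
split; [by []|exact: continuous_hirz_retract|].
move=> _ c [_ [i [j ->]] <-] /orient_atlas[i' [j' ->]].
have SE y : (cmap (boundary_chart (disc_chart k pos i j)) @`
    (dom (boundary_chart (disc_chart k pos i j)) `&` g @^-1` @hirz_dom R k i' j')) y ->
    exists q : hirz, [/\ hirz_dom i j q, hirz_dom i' j' q & y = reflect_if pos (hirz_coord i j q)].
  move=> [p [/boundary_disc_chart[q Dq ->] /=]]; rewrite hirz_embedK => Dq' <-.
  by exists q; split=> //; rewrite rsubmx_mirror chart_map_hirz// row_mxKr.
apply: (elementary_smooth_on (@boundary_dom_open R k pos i j i' j') _
    (@elementary_boundary_transition R k pos i j i' j')).
  by move=> y /SE[q [Dq Dq' ->]]; have [] := boundary_dom_hirz Dq Dq'.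
move=> y /SE[q [Dq Dq' ->]]; rewrite (boundary_dom_hirz Dq Dq').2 /=.
rewrite mirror_row_mx reflect_ifK -chart_map_hirz//.
rewrite (chart_map_disc (disc_set_hirz q) ((hirz_domE _ _ _).1 Dq)).2.
by rewrite hirz_embedK.
Qed.

Lemma hirz_embed_oriented : oriented_diffeomorphism (M := M) (N := Defs.boundary W) f.
Proof.
split; first exact: smooth_hirz_embed.
- exists g; split; first exact: smooth_hirz_retract.
    by move=> q _; exact: hirz_embedK.
  by move=> p /boundary_set[q ->]; rewrite hirz_embedK.
- move=> b c /orient_atlas[i [j ->]] [_ [i' [j' ->]] <-].
  apply: (@positive_onP _ _ _ (boundary_dom k pos i j i' j') _
    (boundary_transition k pos i j i' j')).
  + move=> _ [q [Dq /boundary_disc_chart[q' Dq' /hirz_embed_inj qE]] <-].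
    by rewrite -qE in Dq'; have [] := boundary_dom_hirz Dq Dq'.
  + by move=> y; exact: positive_boundary_transition.
  + by move=> y _; rewrite boundary_transitionE.
Qed.

Lemma hirz_embed_action t q : f (hirz_action t q) = disc_action k t (f q).
Proof.
rewrite /hirz_action hirz_embed_class /hirz_embed /rank1_embed disc_action_embed /=.
rewrite !expi0 !mul1r !nrm2M !nrm2_expi !mul1r mulrA.
by [].
Qed.

End NullCobordism.

Theorem lemma6p1 (R : realType) (k : int) (positive : bool) :
  @torus_cobordism_trivial R 2 4 (orient positive (@hirzebruch R k))
    (@hirz_action R k) /\
  cobordism_trivial (orient positive (@hirzebruch R k)).
Proof.
have Wc := @disc_bundle_compact_oriented R k positive.
have fo := @hirz_embed_oriented R k positive.
split; last by exists (disc_bundle k positive), (@hirz_embed R k).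
exists (disc_bundle k positive), (disc_action k), (@hirz_embed R k); split=> //.
  exact: disc_torus_action.
by move=> t q _; exact: hirz_embed_action.
Qed.
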